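(* Let $d\in\mathbb{N}$ and $q\in(-1,1)$, and consider the operator $$T_{d;q} := \sum_{i=1}^d (L_{i;q}+L_{i;q}^* )(R_{i;q}+R_{i;q}^* )\in B(\mathcal{T}_{d;q}),$$ where $\mathcal{T}_{d;q}$ is the $q$-Fock space over $\mathbb{C}^d$ and $L_{i;q}$, $R_{i;q}$ are the left and right $q$-creation operators associated to the standard basis vector $e_i$. Then $T_{d;q}=T_{d;q}^*$, and its moments with respect to the vacuum-state $\varphi_{\mathrm{vac}}$ are $$\varphi_{\mathrm{vac}}(T_{d;q}^n)=\widetilde{Q}_n(d,q),\qquad \forall\, n\in\mathbb{N}.$$
   Context: $\mathbb{N}=\{1,2,3,\dots\}$; inner products are linear in the first variable; $0^0=1$. $q$-Fock space. For $n\in\mathbb{N}$, equip $(\mathbb{C}^d)^{\otimes n}$ with the inner product determined by $\langle v_1\otimes\cdots\otimes v_n, w_1\otimes\cdots\otimes w_n\rangle_q=\sum_{\tau\in S_n} q^{\iota(\tau)}\prod_{i=1}^n\langle v_i,w_{\tau(i)}\rangle$, where $\iota(\tau)=|\{(i,j): 1\le i<j\le n,\ \tau(i)>\tau(j)\}|$ (this is known to be an inner product). $\mathcal{T}_{d;q}$ is the Hilbert space orthogonal direct sum $\mathbb{C}\oplus\bigoplus_{n\ge1}(\mathbb{C}^d)^{\otimes n}$; the vector $1\in\mathbb{C}$ is the vacuum vector $\xi_{\mathrm{vac}}$, and $\varphi_{\mathrm{vac}}(X)=\langle X\xi_{\mathrm{vac}},\xi_{\mathrm{vac}}\rangle$ for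 $X\in B(\mathcal{T}_{d;q})$. For $v\in\mathbb{C}^d$, $L(v),R(v)\in B(\mathcal{T}_{d;q})$ are the (bounded) operators determined by $L(v)\xi_{\mathrm{vac}}=v=R(v)\xi_{\mathrm{vac}}$, $L(v)(v_1\otimes\cdots\otimes v_n)=v\otimes v_1\otimes\cdots\otimes v_n$, $R(v)(v_1\otimes\cdots\otimes v_n)=v_1\otimes\cdots\otimes v_n\otimes v$. With $e_1,\dots,e_d$ the standard orthonormal basis of $\mathbb{C}^d$, put $L_{i;q}=L(e_i)$, $R_{i;q}=R(e_i)$; $^*$ denotes the adjoint. Polynomials. $\mathcal{P}_2(2n)$ is the set of pair-partitions of $\{1,\dots,2n\}$ (partitions into $n$ blocks of size 2). Two distinct blocks of $\pi\in\mathcal{P}_2(2n)$ cross if, writing their union as $\{a<b<c<d\}$, one block is $\{a,c\}$ and the other $\{b,d\}$; $\mathrm{cr}(\pi)$ is the number of unordered pairs of crossing blocks. $\rho_{2n}=\{\{1,2n\},\{2,2n-1\},\dots,\{n,n+1\}\}$ is the rainbow pair-partition. $\pi\vee\sigma$ is the join in the lattice of all partitions of $\{1,\dots,2n\}$ under reverse refinement order (the finest partition of which both $\pi,\sigma$ are refinements), and $|\cdot|$ is the number of blocks. A self-intersecting meandric system of order $n$ is a pair $(\pi,\sigma)$ in $\mathcal{P}_2(2n)^2$ ($\pi$ drawn above and $\sigma$ below a horizontal line); its number of crossings is $\mathrm{cr}(\pi)+\mathrm{cr}(\sigma)$ and its number of closed curves is $|\pi\vee\sigma|$. Let $r_n^{(k,\ell)}$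 be the number of such systems with $\sigma=\rho_{2n}$ having exactly $k$ closed curves and $\ell$ crossings, and $\widetilde{Q}_n(t,u)=\sum_{k=1}^n\sum_{\ell=0}^{n^2-n} r_n^{(k,\ell)}t^ku^\ell$. Equivalently, $\widetilde{Q}_n(t,u)=\sum_{\pi\in\mathcal{P}_2(2n)}t^{|\pi\vee\rho_{2n}|}u^{\mathrm{cr}(\pi)}$. *)

(* Defs.v *)
From HB Require Import structures.
From mathcomp Require Import all_boot all_order all_algebra all_fingroup.
From mathcomp Require Import complex ring lra.

Set Implicit Arguments.
Unset Strict Implicit.
Unset Printing Implicit Defensive.

Import Order.TTheory GRing.Theory Num.Theory.
Local Open Scope ring_scope.

Definition inversions (n : nat) (t : 'S_n) : nat :=
  #|[set p : 'I_n * 'I_n | (p.1 < p.2)%N && (t p.2 < t p.1)%N]|.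

Section MeandricSystems.
Variable n : nat.
Local Notation T := 'I_(2 * n).
Implicit Types (B D : {set T}) (P Q J K : {set {set T}}).

Definition pair_partition P :=
  partition P [set: T] && [forall B in P, #|B| == 2%N].

Definition interlaced B D :=
  [exists a : T, exists b : T, exists c : T, exists e : T,
    [&& (a < b)%N, (b < c)%N, (c < e)%N, B == [set a; c] & D == [set b; e]]].

Definition crosses B D := interlaced B D || interlaced D B.

(* The unordered pair of distinct blocks B and D is represented by [set B; D]. *)
Definition cr P : nat :=
  #|[set E : {set {set T}} | [exists B in P, exists D in P,
      [&& B != D, E == [set B; D] & crosses B D]]]|.

Definition rainbow : {set {set T}} := [set [set i; rev_ord i] | i : T].

Definition refines P Q := [forall B in P, exists D in Q, B \subset D].

Definition is_join P Q J :=
  [&& partition J [set: T], refines P J, refines Q J &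
    [forall K : {set {set T}},
      [&& partition K [set: T], refines P K & refines Q K] ==> refines J K]].

Definition partition_join P Q : {set {set T}} :=
  odflt set0 [pick J | is_join P Q J].

Definition meandric_system (s : {set {set T}} * {set {set T}}) :=
  pair_partition s.1 && pair_partition s.2.

Definition crossings (s : {set {set T}} * {set {set T}}) : nat :=
  (cr s.1 + cr s.2)%N.

Definition closed_curves (s : {set {set T}} * {set {set T}}) : nat :=
  #|partition_join s.1 s.2|.

Definition rainbow_count (k l : nat) : nat :=
  #|[set s : {set {set T}} * {set {set T}} |
      [&& meandric_system s, s.2 == rainbow, closed_curves s == k &
          crossings s == l]]|.

Definition Qtilde (R : pzRingType) (t u : R) : R :=
  \sum_(1 <= k < n.+1) \sum_(0 <= l < (n ^ 2 - n).+1)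
    (rainbow_count k l)%:R * t ^+ k * u ^+ l.

End MeandricSystems.

(* Loaded only now, because [classical_sets] redefines [partition]. *)
From mathcomp Require Import boolp classical_sets functions reals topology.
From mathcomp Require Import normedtype sequences.
Import numFieldNormedType.Exports.
Local Open Scope complex_scope.
Local Open Scope ring_scope.

(* [Re] and [Im] are the R-valued parts of R[i], not the R[i]-valued ['Re], ['Im]. *)
Local Notation Re := complex.Re.
Local Notation Im := complex.Im.

Section Tensor.
Variables (R : realType) (d : nat).
Notation C := R[i].

(* An element of the n-th tensor power of C^d is given by its coordinates in
   the basis e_(s 0) (x) ... (x) e_(s n.-1), indexed by the words s. *)
Definition word (n : nat) : finType := {ffun 'I_n -> 'I_d}.
Definition tensor (n : nat) : lmodType C := {ffun word n -> C}.

Definition vdot (v w : 'rV[C]_d) : C := \sum_j v 0 j * (w 0 j)^*.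

Definition tens (n : nat) (v : 'I_n -> 'rV[C]_d) : tensor n :=
  [ffun s : word n => \prod_(i < n) v i 0 (s i)].

Variable q : R.

(* The sesquilinear form with the Gram matrix of the basis tensors that the
   formula on elementary tensors prescribes; [qdot_tens] recovers that formula. *)
Definition qdot (n : nat) (x y : tensor n) : C :=
  \sum_(s : word n) \sum_(t : word n) x s * (y t)^* *
    \sum_(tau : 'S_n) q%:C ^+ inversions tau * \prod_(i < n) (s i == t (tau i))%:R.

Definition wperm n (tau : 'S_n) (t : word n) : word n := [ffun i => t (tau i)].

Lemma qdotE n (x y : tensor n) :
  qdot x y = \sum_(tau : 'S_n) q%:C ^+ inversions tau *
    \sum_(t : word n) x (wperm tau t) * (y t)^*.
Proof.
rewrite /qdot exchange_big /=.
under eq_bigr => t _.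
  under eq_bigr => s _ do rewrite mulr_sumr.
  rewrite exchange_big /=.
  over.
rewrite exchange_big /=; apply: eq_bigr => tau _; rewrite mulr_sumr.
apply: eq_bigr => t _.
rewrite (bigD1 (wperm tau t)) //= [X in _ + X = _]big1 => [|s ns].
  rewrite addr0 big1 => [|i _]; last by rewrite ffunE eqxx.
  by rewrite mulr1 mulrC.
suff [i hi]: exists i, s i != t (tau i).
  by rewrite (bigD1 i) //= (negbTE hi) mul0r !mulr0.
apply/existsP; rewrite -negb_forall; apply: contra ns => /forallP h.
by apply/eqP/ffunP => i; rewrite ffunE; apply/eqP.
Qed.

Lemma qdot_tens n (v w : 'I_n -> 'rV[C]_d) :
  qdot (tens v) (tens w) = \sum_(tau : 'S_n) q%:C ^+ inversions tau *
    \prod_(i < n) vdot (v i) (w (tau i)).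
Proof.
rewrite qdotE; apply: eq_bigr => tau _; congr (_ * _).
rewrite /vdot bigA_distr_bigA /=.
have wpK : cancel (wperm tau) (wperm tau^-1).
  by move=> t; apply/ffunP => i; rewrite !ffunE permKV.
have wpKV : cancel (wperm tau^-1) (wperm tau).
  by move=> t; apply/ffunP => i; rewrite !ffunE permK.
rewrite [RHS](reindex (wperm tau)) /=; last by exists (wperm tau^-1) => t _.
apply: eq_bigr => t _.
rewrite big_split /= !ffunE; congr (_ * _).
rewrite rmorph_prod (reindex_inj (@perm_inj _ tau)) /=.
by apply: eq_bigr => i _; rewrite ffunE.
Qed.

Lemma qdot_linearl n (y : tensor n) : GRing.linear_for *%R (qdot (n := n) ^~ y).
Proof.
move=> a x z /=; rewrite /qdot mulr_sumr -big_split /=; apply: eq_bigr => s _.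
rewrite mulr_sumr -big_split /=; apply: eq_bigr => t _.
by rewrite !ffunE !mulrDl !mulrA.
Qed.

Lemma qdotC n (x y : tensor n) : qdot x y = (qdot y x)^*.
Proof.
rewrite !qdotE rmorph_sum (reindex_inj invg_inj) /=; apply: eq_bigr => tau _.
rewrite rmorphM rmorphXn [X in _ = X ^+ _ * _]conjc_real; congr (_ ^+ _ * _).
  rewrite /inversions.
  have inj : injective (fun p : 'I_n * 'I_n => (tau p.2, tau p.1)).
    by move=> [a b] [a' b'] [/perm_inj -> /perm_inj ->].
  rewrite -[RHS](card_imset _ inj); apply: eq_card => -[a b]; rewrite !inE /=.
  apply/andP/imsetP => /= [[ab tba]|[[a' b']]].
    by exists ((tau^-1)%g b, (tau^-1)%g a); rewrite ?inE /= ?permKV // tba ab.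
  by rewrite inE /= => /andP[lt1 lt2] [-> ->]; rewrite !permK lt1 lt2.
rewrite rmorph_sum [LHS](reindex (wperm tau)) /=; last first.
  exists (wperm tau^-1) => t _; apply/ffunP => i; rewrite !ffunE ?permK ?permKV //.
apply: eq_bigr => t _; rewrite rmorphM [RHS]mulrC; congr (_ * _); rewrite [RHS]conjCK.
by congr (x _); apply/ffunP => i; rewrite !ffunE permKV.
Qed.

Lemma qdot_linearr n (x : tensor n) :
  GRing.linear_for (Num.conj \; *%R) (qdot (n := n) x).
Proof.
move=> a y z /=.
by rewrite qdotC qdot_linearl rmorphD rmorphM; congr (_ * _ + _); rewrite [RHS]qdotC.
Qed.

Hypothesis hq : -1 < q < 1.

(* Positivity: q ^ inversions (a * b^-1) is a product over pairs p of kernels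
   equal to 1 or q according to whether a and b order p alike; each of these is a
   combination of 1 and of a product of signs with positive coefficients. *)
Section Kernel.
Variables n : nat.
Implicit Types (v : 'S_n -> C) (p : 'I_n * 'I_n) (a b : 'S_n).

Definition inverted p a := (a^-1 p.2 < a^-1 p.1)%g%N.
Definition disagree p a b := inverted p a != inverted p b.

Definition kform (ps : seq ('I_n * 'I_n)) v : C :=
  \sum_a \sum_b (\prod_(p <- ps) (if disagree p a b then q%:C else 1)) *
    (v a * (v b)^*).

Definition sgp p v a : C := (if inverted p a then -1 else 1) * v a.

Let c0 : C := ((1 + q) / 2)%:C.
Let c1 : C := ((1 - q) / 2)%:C.

Lemma c0_gt0 : 0 < c0. Proof. case/andP: hq => h1 h2; rewrite ltcR; lra. Qed.
Lemma c1_gt0 : 0 < c1. Proof. case/andP: hq => h1 h2; rewrite ltcR; lra. Qed.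

Lemma kform_cons p ps v :
  kform (p :: ps) v = c0 * kform ps v + c1 * kform ps (sgp p v).
Proof.
rewrite /kform !mulr_sumr -big_split /=; apply: eq_bigr => a _.
rewrite !mulr_sumr -big_split /=; apply: eq_bigr => b _.
rewrite big_cons /sgp /disagree rmorphM.
set P := \prod_(_ <- _) _.
have e1 : (c0 + c1 = 1) by rewrite -rmorphD -[RHS](rmorph1 (real_complex R)); congr (_%:C); field.
have e2 : (c0 - c1 = q%:C) by rewrite -rmorphB; congr (_%:C); field.
have eN z : (- z)^* = - z^* by rewrite rmorphN.
by case: (inverted p a); case: (inverted p b); rewrite /= !(mulN1r, mul1r, eN, rmorph1);
  (rewrite -e2 || rewrite -[LHS]mul1r -e1); ring.
Qed.

Lemma kform_ge0 ps v : 0 <= kform ps v.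
Proof.
elim: ps v => [|p ps IH] v; last first.
  by rewrite kform_cons addr_ge0 // mulr_ge0 ?IH // ltW ?c0_gt0 ?c1_gt0.
suff -> : kform [::] v = (\sum_a v a) * (\sum_a v a)^* by exact: mul_conjC_ge0.
rewrite /kform rmorph_sum mulr_suml; apply: eq_bigr => a _ /=.
by rewrite mulr_sumr; apply: eq_bigr => b _; rewrite big_nil mul1r.
Qed.

Lemma kform_eq0 ps v a0 : kform ps v = 0 ->
  \sum_(a | all (fun p => ~~ disagree p a a0) ps) v a = 0.
Proof.
elim: ps v => [|p ps IH] v.
  rewrite /=; suff -> : kform [::] v = (\sum_a v a) * (\sum_a v a)^*.
    by move/eqP; rewrite mul_conjC_eq0 => /eqP.
  rewrite /kform rmorph_sum mulr_suml; apply: eq_bigr => a _ /=.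
  by rewrite mulr_sumr; apply: eq_bigr => b _; rewrite big_nil mul1r.
move/eqP; rewrite kform_cons paddr_eq0; last 2 first.
- by rewrite mulr_ge0 ?kform_ge0 // ltW ?c0_gt0.
- by rewrite mulr_ge0 ?kform_ge0 // ltW ?c1_gt0.
rewrite !mulf_eq0 (gt_eqF c0_gt0) (gt_eqF c1_gt0) /=.
move=> /andP[/eqP/IH h0 /eqP/IH h1].
set s : C := if inverted p a0 then -1 else 1.
have: \sum_(a | all (fun p0 => ~~ disagree p0 a a0) ps) (v a + s * sgp p v a) = 0.
  by rewrite big_split /= -mulr_sumr h0 h1 mulr0 addr0.
rewrite (bigID (fun a => ~~ disagree p a a0)) /=.
rewrite [X in _ + X]big1 ?addr0; last first.
  move=> a /andP[_]; rewrite negbK /disagree /sgp /s.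
  by case: (inverted p a); case: (inverted p a0) => // _; ring.
rewrite (eq_bigr (fun a => 2 * v a)); last first.
  move=> a /andP[_]; rewrite /disagree /sgp /s.
  by case: (inverted p a); case: (inverted p a0) => // _; ring.
rewrite -mulr_sumr => /eqP; rewrite mulf_eq0 pnatr_eq0 /= => /eqP h.
by rewrite -[RHS]h; apply: eq_bigl => a; rewrite andbC.
Qed.

Definition pairs := [seq p : 'I_n * 'I_n <- enum {: 'I_n * 'I_n} | (p.1 < p.2)%N].

Lemma inversions_disagree a b :
  inversions (a * b^-1) = count (fun p => disagree p a b) pairs.
Proof.
have -> : count (fun p => disagree p a b) pairs
  = #|[set p : 'I_n * 'I_n | (p.1 < p.2)%N && disagree p a b]|.
  rewrite cardE /pairs count_filter -size_filter /enum_mem -filter_predI.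
  congr size; apply: eq_filter => p.
  by rewrite /= !inE andbT andbC.
rewrite /inversions.
pose f (p : 'I_n * 'I_n) := if (a p.1 < a p.2)%N then (a p.1, a p.2) else (a p.2, a p.1).
pose A := [set p : 'I_n * 'I_n | (p.1 < p.2)%N && ((a * b^-1)%g p.2 < (a * b^-1)%g p.1)%N].
have injf : {in A &, injective f}.
  move=> [i j] [k l]; rewrite !inE /f /= => /andP[ij _] /andP[kl _].
  case: ifP => _; case: ifP => _ [/perm_inj e1 /perm_inj e2]; subst => //.
    by move: (ltn_trans ij kl); rewrite ltnn.
  by move: (ltn_trans ij kl); rewrite ltnn.
rewrite -[LHS]/#|A| -(card_in_imset injf); apply: eq_card => -[x y]; rewrite !inE /=.
apply/imsetP/andP => [[[i j]]|[xy dis]].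
  rewrite inE /f /= !permM => /andP[ij ba].
  have aij : a i != a j by rewrite (inj_eq perm_inj) neq_ltn ij.
  case: (ltngtP (a i) (a j)) => [lt|lt|e]; last by move/eqP: aij => /(_ (val_inj e)).
    move=> [-> ->]; split => //; rewrite /disagree /inverted /= !permK.
    by rewrite ba ltnNge (ltnW ij).
  move=> [-> ->]; split => //; rewrite /disagree /inverted /= !permK.
  by rewrite ij ltnNge (ltnW ba).
move: dis; rewrite /disagree /inverted /=.
set i := (a^-1)%g x; set j := (a^-1)%g y.
have ai : a i = x by rewrite permKV.
have aj : a j = y by rewrite permKV.
have ij : i != j by apply: contraTneq xy => e; rewrite -ai -aj e ltnn.
have bij : (b^-1)%g x != (b^-1)%g y by rewrite (inj_eq perm_inj) neq_ltn xy.
case: (ltngtP j i) => [ji|lij|e]; last by move/eqP: ij => /(_ (esym (val_inj e))).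
- rewrite eq_sym eqb_id -leqNgt => hb; exists (j, i); last by rewrite /f /= ai aj ltnNge (ltnW xy).
  by rewrite inE /= ji !permM ai aj ltn_neqAle bij hb.
- rewrite eq_sym eqbF_neg negbK => hb; exists (i, j); last by rewrite /f /= ai aj xy.
  by rewrite inE /= lij !permM ai aj hb.
Qed.

Lemma kform_pairs v :
  kform pairs v = \sum_a \sum_b q%:C ^+ inversions (a * b^-1) * (v a * (v b)^*).
Proof.
apply: eq_bigr => a _; apply: eq_bigr => b _; congr (_ * _).
rewrite inversions_disagree; elim: pairs => [|p ps IH] /=; first by rewrite big_nil.
by rewrite big_cons IH; case: disagree; rewrite ?mul1r // exprS.
Qed.

Lemma agree_pairs1 a : all (fun p => ~~ disagree p a 1%g) pairs -> a = 1%g.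
Proof.
move=> /allP h; apply: invg_inj; rewrite invg1.
have mono (i j : 'I_n) : (i < j)%N -> ((a^-1)%g i < (a^-1)%g j)%N.
  move=> ij; have := h (i, j); rewrite mem_filter /= ij mem_enum => /(_ isT).
  rewrite /disagree /inverted /= invg1 !perm1 negbK [(j < i)%N]ltnNge (ltnW ij) /=.
  rewrite eqbF_neg -leqNgt leq_eqVlt => /orP[/eqP/val_inj/perm_inj e|//].
  by rewrite e ltnn in ij.
apply/permP => i; rewrite perm1.
suff e : [seq (a^-1)%g i | i <- enum 'I_n] = enum 'I_n.
  have := congr1 (fun s => nth i s i) e.
  by rewrite (nth_map i) ?size_enum_ord // !nth_ord_enum.
apply: (sorted_eq (leT := fun i j : 'I_n => (i <= j)%N)).
- by move=> x y z; apply: leq_trans.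
- by move=> x y /anti_leq/val_inj.
- apply: (homo_sorted (e := fun i j : 'I_n => (i < j)%N)).
    by move=> x y xy; exact/ltnW/mono.
  by have := iota_ltn_sorted 0 n; rewrite -val_enum_ord sorted_map.
- by have := iota_sorted 0 n; rewrite -val_enum_ord sorted_map.
- apply: uniq_perm; [|exact: enum_uniq|].
    by rewrite (map_inj_uniq (@perm_inj _ (a^-1)%g)) enum_uniq.
  move=> x; rewrite mem_enum; apply/mapP; exists (a x); rewrite ?mem_enum //.
  by rewrite permK.
Qed.

End Kernel.

Lemma qdot_kform n (x : tensor n) :
  qdot x x *+ #|{: 'S_n}| = \sum_(t : word n) kform (pairs n) (fun a => x (wperm a t)).
Proof.
rewrite -sumr_const qdotE.
rewrite (eq_bigr (fun t => \sum_b \sum_a q%:C ^+ inversions (a * b^-1) * (x (wperm a t) * (x (wperm b t))^*))); last first.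
  by move=> t _; rewrite kform_pairs exchange_big.
rewrite [RHS]exchange_big /=; apply: eq_big => [b|b _]; first by rewrite inE. 
rewrite [RHS]exchange_big /= [LHS](reindex_inj (mulIg (b^-1)%g)) /=; apply: eq_bigr => a _.
rewrite -mulr_sumr; congr (_ * _).
rewrite (reindex (wperm b)) /=; last first.
  exists (wperm b^-1) => t _; apply/ffunP => i; rewrite !ffunE ?permK ?permKV //.
apply: eq_bigr => t _; congr (x _ * _).
by apply/ffunP => i; rewrite !ffunE permM permKV.
Qed.

Lemma qdot_ge0 n (x : tensor n) : 0 <= qdot x x.
Proof.
rewrite -(pmulrn_lge0 _ (n := #|{: 'S_n}|)); last by apply/card_gt0P; exists 1%g.
by rewrite qdot_kform sumr_ge0 // => t _; exact: kform_ge0.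
Qed.

Lemma qdot_gt0 n (x : tensor n) : x != 0 -> 0 < qdot x x.
Proof.
move=> x0; rewrite lt_def qdot_ge0 andbT; apply: contra x0 => /eqP e.
have := qdot_kform x; rewrite e mul0rn => /esym/eqP.
rewrite psumr_eq0; last by move=> t _; exact: kform_ge0.
move=> /allP h; apply/eqP/ffunP => t; rewrite ffunE.
have /eqP/(kform_eq0 1%g) := h t (mem_index_enum _).
rewrite (big_pred1 1%g) /=; first by move=> <-; congr (x _); apply/ffunP => i; rewrite ffunE perm1.
move=> a; apply/idP/eqP => [/agree_pairs1//|->].
by apply/allP => p _; rewrite /disagree eqxx.
Qed.

End Tensor.

Section ComplexSeries.
Variable R : realType.
Implicit Types u v : nat -> R[i].

(* Convergence and sum of a complex series, through its real and imaginary parts. *)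
Definition csummable u :=
  cvgn (series (fun n => Re (u n))) /\ cvgn (series (fun n => Im (u n))).

Definition csum u : R[i] :=
  limn (series (fun n => Re (u n))) +i* limn (series (fun n => Im (u n))).

Lemma csummable_lin a u v : csummable u -> csummable v ->
  csummable (fun n => a * u n + v n).
Proof.
case: a => a b [ru iu] [rv iv]; split.
  rewrite (_ : (fun _ => _) = (a *: (fun n => Re (u n)) - b *: (fun n => Im (u n)))
     + (fun n => Re (v n))).
    by apply: is_cvg_seriesD => //; apply: is_cvg_seriesB; exact: is_cvg_seriesZ.
  by apply/funext => n /=; rewrite !fctE; case: (u n); case: (v n).
rewrite (_ : (fun _ => _) = (a *: (fun n => Im (u n)) + b *: (fun n => Re (u n)))
     + (fun n => Im (v n))).
  by apply: is_cvg_seriesD => //; apply: is_cvg_seriesD; exact: is_cvg_seriesZ.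
by apply/funext => n /=; rewrite !fctE; case: (u n); case: (v n).
Qed.

Lemma csum_lin a u v : csummable u -> csummable v ->
  csum (fun n => a * u n + v n) = a * csum u + csum v.
Proof.
case: a => a b [ru iu] [rv iv]; rewrite /csum.
rewrite (_ : (fun n => Re ((a +i* b) * u n + v n)) = (a *: (fun n => Re (u n)) - b *: (fun n => Im (u n)))
     + (fun n => Re (v n))); last first.
  by apply/funext => n /=; rewrite !fctE; case: (u n); case: (v n).
rewrite (_ : (fun n => Im ((a +i* b) * u n + v n)) = (a *: (fun n => Im (u n)) + b *: (fun n => Re (u n)))
     + (fun n => Im (v n))); last first.
  by apply/funext => n /=; rewrite !fctE; case: (u n); case: (v n).
rewrite (lim_seriesD (is_cvg_seriesB (is_cvg_seriesZ (k := a) ru) (is_cvg_seriesZ (k := b) iu)) rv).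
rewrite (lim_seriesD (is_cvg_seriesD (is_cvg_seriesZ (k := a) iu) (is_cvg_seriesZ (k := b) ru)) iv).
rewrite (lim_seriesB (is_cvg_seriesZ (k := a) ru) (is_cvg_seriesZ (k := b) iu)).
rewrite (lim_seriesD (is_cvg_seriesZ (k := a) iu) (is_cvg_seriesZ (k := b) ru)).
by rewrite (lim_seriesZ a ru) (lim_seriesZ b iu) (lim_seriesZ a iu) (lim_seriesZ b ru).
Qed.

Lemma csum_conj u : csummable u -> csum (fun n => (u n)^*) = (csum u)^*.
Proof.
move=> [ru iu]; rewrite /csum.
rewrite (_ : (fun n => Re (u n)^*) = (fun n => Re (u n))); last first.
  by apply/funext => n /=; case: (u n).
rewrite (_ : (fun n => Im (u n)^*) = - (fun n => Im (u n))); last first.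
  by apply/funext => n /=; rewrite !fctE; case: (u n).
by rewrite lim_seriesN.
Qed.

End ComplexSeries.

Section Fock.
Variables (R : realType) (d : nat) (q : R) (hq : -1 < q < 1).
Notation C := R[i].
Notation tensor := (tensor R d).
Notation dot := (@qdot R d q _).

Definition summable_tensors (x : forall n, tensor n) : Prop :=
  cvgn (series (fun n => Re (dot (x n) (x n)))).

Lemma Im_qdot n (x : tensor n) : Im (dot x x) = 0.
Proof. by apply: ger0_Im; exact: (qdot_ge0 hq). Qed.

Lemma Re_qdot_ge0 n (x : tensor n) : 0 <= Re (dot x x).
Proof. by have := qdot_ge0 hq x; rewrite lecE => /andP[_]. Qed.

Lemma qdot_lin n a (x y z : tensor n) : dot (a *: x + y) z = a * dot x z + dot y z.
Proof. exact: qdot_linearl. Qed.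

Lemma qdot_linr n a (x y z : tensor n) : dot z (a *: x + y) = a^* * dot z x + dot z y.
Proof. exact: qdot_linearr. Qed.

Lemma qdot0l n (z : tensor n) : dot 0 z = 0.
Proof. by rewrite /qdot big1 // => s _; rewrite big1 // => t _; rewrite ffunE !mul0r. Qed.

Lemma qdot_sq n a (x y : tensor n) : 
  Re (dot (a *: x + y) (a *: x + y)) = Re (a * a^*) * Re (dot x x) +
    2 * Re (a * dot x y) + Re (dot y y).
Proof.
rewrite qdot_lin !qdot_linr (qdotC q y x).
have := Im_qdot x; case: (dot x x) => s s' /= ->.
case: (dot x y) => t t'; case: (dot y y) => w w'; case: a => a a' /=; ring.
Qed.

Lemma summable0 : summable_tensors (fun n => 0).
Proof.
rewrite /summable_tensors (_ : (fun n => _) = fun=> 0).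
  by rewrite (_ : series _ = fun=> 0); [exact: is_cvg_cst|apply/funext => n; rewrite /series /= big1].
by apply/funext => n; rewrite qdot0l.
Qed.

Lemma summable_lin a x y : summable_tensors x -> summable_tensors y ->
  summable_tensors (fun n => a *: x n + y n).
Proof.
move=> sx sy.
apply: (@series_le_cvg _ _ ((2 * Re (a * a^*)) *: (fun n => Re (dot (x n) (x n)))
  + 2 *: (fun n => Re (dot (y n) (y n))))).
- by move=> n; exact: Re_qdot_ge0.
- move=> n; rewrite !fctE addr_ge0 // mulr_ge0 ?Re_qdot_ge0 //.
  by rewrite mulr_ge0 //; case: a => r s /=; nra.
- move=> n; rewrite !fctE.
  have h : 0 <= Re (- a * (- a)^*) * Re (dot (x n) (x n)) +
      2 * Re (- a * dot (x n) (y n)) + Re (dot (y n) (y n)).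
    by rewrite -qdot_sq Re_qdot_ge0.
  rewrite [X in X <= _]qdot_sq; move: h.
  move: (dot (x n) (x n)) (dot (x n) (y n)) (dot (y n) (y n)) => [s s'] [t t'] [w w'].
  case: a => a a'; rewrite /GRing.scale /=; lra.
- by apply: is_cvg_seriesD; exact: is_cvg_seriesZ.
Qed.

Lemma csummable_qdot x y : summable_tensors x -> summable_tensors y ->
  csummable (fun n => dot (x n) (y n)).
Proof.
have H z w : summable_tensors z -> summable_tensors w ->
    cvgn (series (fun n => Re (dot (z n) (w n)))).
  move=> sz sw.
  rewrite (_ : (fun n => _) = 2^-1 *: ((fun n => Re (dot (1 *: z n + w n) (1 *: z n + w n))) - (fun n => Re (dot (z n) (z n))) - (fun n => Re (dot (w n) (w n))))).
    apply: is_cvg_seriesZ; apply: is_cvg_seriesB => //; apply: is_cvg_seriesB => //.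
    exact: summable_lin.
  apply/funext => n; rewrite !fctE qdot_sq rmorph1 !mul1r /GRing.scale /=; by field.
move=> sx sy; split; first exact: H.
rewrite (_ : (fun n => _) = fun n => Re (dot (- 'i *: x n + 0) (y n))).
  by apply: (H _ _ _ sy); apply: summable_lin => //; exact: summable0.
apply/funext => n; rewrite qdot_lin qdot0l.
by case: (dot (x n) _) => s t; rewrite /=; ring.
Qed.

(* The Hilbert space direct sum of the tensor powers. The parameter [hq] is a
   phantom: the vector space and inner product instances below depend on it. *)
Record fock_space (hq' : -1 < q < 1) : Type := Fock {
  component :> forall n, tensor n;
  component_summable : summable_tensors component }.
Notation fock := (fock_space hq).
Arguments component_summable {_} x : rename.
Local Notation MkFock := (@Fock hq _).

Lemma fockP (x y : fock) : (forall n, x n = y n) -> x = y.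
Proof.
case: x y => [x sx] [y sy] /= e; have {}e : x = y by apply: functional_extensionality_dep.
by subst y; congr (@Fock hq _); exact: Prop_irrelevance.
Qed.

HB.instance Definition _ := gen_eqMixin fock.
HB.instance Definition _ := gen_choiceMixin fock.

Lemma summable_add x y : summable_tensors x -> summable_tensors y ->
  summable_tensors (fun n => x n + y n).
Proof.
move=> sx sy; have := summable_lin (a := 1) sx sy.
by congr summable_tensors; apply: functional_extensionality_dep => n; rewrite scale1r.
Qed.

Lemma summable_scale a x : summable_tensors x -> summable_tensors (fun n => a *: x n).
Proof.
move=> sx; have := summable_lin (a := a) sx summable0.
by congr summable_tensors; apply: functional_extensionality_dep => n; rewrite addr0.
Qed.

Lemma summable_opp x : summable_tensors x -> summable_tensors (fun n => - x n).
Proof.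
move=> /(summable_scale (a := -1)).
by congr summable_tensors; apply: functional_extensionality_dep => n; rewrite scaleN1r.
Qed.

Definition fock_zero := MkFock summable0.
Definition fock_add (x y : fock)   := MkFock (summable_add (component_summable x) (component_summable y)).
Definition fock_opp (x : fock)   := MkFock (summable_opp (component_summable x)).
Definition fock_scale (a : C) (x : fock) := MkFock (summable_scale (a := a) (component_summable x)).

Fact fock_addA : associative fock_add.
Proof. by move=> x y z; apply: fockP => n; exact: addrA. Qed.
Fact fock_addC : commutative fock_add.
Proof. by move=> x y; apply: fockP => n; exact: addrC. Qed.
Fact fock_add0 : left_id fock_zero fock_add.
Proof. by move=> x; apply: fockP => n; exact: add0r. Qed.
Fact fock_addN : left_inverse fock_zero fock_opp fock_add.
Proof. by move=> x; apply: fockP => n; exact: addNr. Qed.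
HB.instance Definition _ := GRing.isZmodule.Build fock fock_addA fock_addC fock_add0 fock_addN.

Fact fock_scaleA a b x : fock_scale a (fock_scale b x) = fock_scale (a * b) x.
Proof. by apply: fockP => n; exact: scalerA. Qed.
Fact fock_scale1 : left_id 1 fock_scale.
Proof. by move=> x; apply: fockP => n; exact: scale1r. Qed.
Fact fock_scaleDr : right_distributive fock_scale +%R.
Proof. by move=> a x y; apply: fockP => n; exact: scalerDr. Qed.
Fact fock_scaleDl x : {morph fock_scale^~ x : a b / a + b}.
Proof. by move=> a b; apply: fockP => n; exact: scalerDl. Qed.
HB.instance Definition _ := GRing.Zmodule_isLmodule.Build C fock
  fock_scaleA fock_scale1 fock_scaleDr fock_scaleDl.

Definition fdot (x y : fock) : C := csum (fun n => dot (x n) (y n)).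

Fact fdot_linearl (y : fock) : GRing.linear_for *%R (fdot ^~ y).
Proof.
move=> a x z; rewrite /fdot -csum_lin; try exact: csummable_qdot (component_summable _) (component_summable _).
by congr csum; apply/funext => n; exact: qdot_lin.
Qed.

Fact fdotC (x y : fock) : fdot x y = (-1) ^+ false * (fdot y x)^*.
Proof.
rewrite expr0 mul1r /fdot -csum_conj; last exact: csummable_qdot (component_summable _) (component_summable _).
by congr csum; apply/funext => n; exact: qdotC.
Qed.

Fact fdot_linearr (x : fock) : GRing.linear_for (Num.conj \; *%R) (fdot x).
Proof.
move=> a y z; rewrite [LHS]fdotC fdot_linearl expr0 mul1r rmorphD rmorphM.
by rewrite [fdot x y]fdotC [fdot x z]fdotC expr0 !mul1r.
Qed.

HB.instance Definition _ := bilinear_isBilinear.Build C fock fock C *%R (Num.conj \; *%R)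
  fdot (fdot_linearl, fdot_linearr).
HB.instance Definition _ := isHermitianSesquilinear.Build C fock false Num.conj fdot fdotC.

Fact fdot_gt0 (x : fock) : x != 0 -> 0 < fdot x x.
Proof.
move=> x0.
have [n xn0] : exists n, x n != 0.
  apply: contrapT => h; move/eqP: x0; apply; apply: fockP => n; apply/eqP.
  by apply: contrapT => /negP xn; apply: h; exists n.
rewrite /fdot /csum ltcE /= [X in limn (series X)](_ : _ = fun=> 0); last first.
  by apply/funext => m; exact: Im_qdot.
rewrite (_ : series _ = fun=> 0); last by apply/funext => m; rewrite /series /= big1.
rewrite lim_cst // eqxx /=.
apply: (@lt_le_trans _ _ (Re (dot (x n) (x n)))).
  by have := qdot_gt0 hq xn0; rewrite ltcE => /andP[_].
apply: (@le_trans _ _ (series (fun n => Re (dot (x n) (x n))) n.+1)).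
  rewrite seriesSr; rewrite lerDr sumr_ge0 // => m _; exact: Re_qdot_ge0.
apply: nondecreasing_cvgn_le; last exact: component_summable.
by apply: nondecreasing_series => m _ _; exact: Re_qdot_ge0.
Qed.
HB.instance Definition _ := isDotProduct.Build C fock fdot fdot_gt0.

End Fock.

Section BoundedOperators.
Variables (R : realType) (H : lmodType R[i]) (form : {dot H for Num.conj}).

Definition hnorm (x : H) : R := Num.sqrt (Re (form x x)).

Record bounded_op : Type := BoundedOp {
  bop_fun :> H -> H;
  bop_linear : linear bop_fun;
  bop_bounded : exists M : R, forall x, hnorm (bop_fun x) <= M * hnorm x }.
Local Notation bop := bounded_op.

Lemma bopP (A B : bop) : (forall x, A x = B x) -> A = B.
Proof.
case: A B => [A lA bA] [B lB bB] /= /funext e; subst B.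
by congr BoundedOp; exact: Prop_irrelevance.
Qed.

HB.instance Definition _ := gen_eqMixin bop.
HB.instance Definition _ := gen_choiceMixin bop.

Let N (x : H) : R := Re (form x x).

Lemma N_ge0 x : 0 <= N x.
Proof. by have := dnorm_ge0 form x; rewrite lecE => /andP[]. Qed.

Lemma bounded_sqr (A : H -> H) :
  (exists M : R, forall x, hnorm (A x) <= M * hnorm x) <->
  (exists2 K : R, 0 <= K & forall x, N (A x) <= K * N x).
Proof.
split=> [[M hM]|[K K0 hK]].
  exists (M ^+ 2) => [|x]; first exact: sqr_ge0.
  rewrite -[N (A x)]sqr_sqrtr ?N_ge0 // -[N x]sqr_sqrtr ?N_ge0 // -exprMn.
  rewrite ler_sqr ?nnegrE ?sqrtr_ge0 ?hM //.
  by apply: le_trans (hM x); exact: sqrtr_ge0.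
exists (Num.sqrt K) => x; rewrite /hnorm -sqrtrM //.
exact: ler_wsqrtr (hK x).
Qed.

Lemma NB_ge0 x y : N (x + y) <= 2 * N x + 2 * N y.
Proof.
have := N_ge0 (x - y); rewrite /N hnormB hnormD !raddfB !raddfD /=; lra.
Qed.

Lemma NN x : N (- x) = N x. Proof. by rewrite /N hnormN. Qed.

Fact bop0_linear : linear (fun _ : H => 0 : H).
Proof. by move=> a x y; rewrite scaler0 addr0. Qed.
Fact bop0_bounded : exists M : R, forall x : H, hnorm ((fun _ : H => 0 : H) x) <= M * hnorm x.
Proof. by exists 0 => x; rewrite mul0r /hnorm linear0l sqrtr0. Qed.
Definition bop0 := BoundedOp bop0_linear bop0_bounded.

Fact bopD_linear (A B : bop) : linear (fun x => A x + B x).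
Proof. by move=> a x y; rewrite !bop_linear scalerDr addrACA. Qed.
Fact bopD_bounded (A B : bop) :
  exists M : R, forall x, hnorm (A x + B x) <= M * hnorm x.
Proof.
apply/bounded_sqr.
have /bounded_sqr[K K0 hK] := bop_bounded A.
have /bounded_sqr[L L0 hL] := bop_bounded B.
exists (2 * K + 2 * L) => [|x]; first lra.
have := NB_ge0 (A x) (B x); have := hK x; have := hL x; lra.
Qed.
Definition bopD A B := BoundedOp (bopD_linear A B) (bopD_bounded A B).

Fact bopN_linear (A : bop) : linear (fun x => - A x).
Proof. by move=> a x y; rewrite !bop_linear opprD scalerN. Qed.
Fact bopN_bounded (A : bop) :
  exists M : R, forall x, hnorm (- A x) <= M * hnorm x.
Proof.
by have [M hM] := bop_bounded A; exists M => x; rewrite /hnorm hnormN; exact: hM.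
Qed.
Definition bopN A := BoundedOp (bopN_linear A) (bopN_bounded A).

Fact bop1_linear : linear (fun x : H => x). Proof. by []. Qed.
Fact bop1_bounded : exists M : R, forall x : H, hnorm x <= M * hnorm x.
Proof. by exists 1 => x; rewrite mul1r. Qed.
Definition bop1 := BoundedOp bop1_linear bop1_bounded.

Fact bopM_linear (A B : bop) : linear (fun x => A (B x)).
Proof. by move=> a x y; rewrite !bop_linear. Qed.
Fact bopM_bounded (A B : bop) :
  exists M : R, forall x, hnorm (A (B x)) <= M * hnorm x.
Proof.
apply/(bounded_sqr (fun x => A (B x))).
have /bounded_sqr[K K0 hK] := bop_bounded A.
have /bounded_sqr[L L0 hL] := bop_bounded B.
exists (K * L) => [|x]; first exact: mulr_ge0.
by apply: (le_trans (hK _)); rewrite -mulrA ler_wpM2l.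
Qed.
Definition bopM A B := BoundedOp (bopM_linear A B) (bopM_bounded A B).

Fact bop_addA : associative bopD.
Proof. by move=> A B D; apply: bopP => x; exact: addrA. Qed.
Fact bop_addC : commutative bopD.
Proof. by move=> A B; apply: bopP => x; exact: addrC. Qed.
Fact bop_add0 : left_id bop0 bopD.
Proof. by move=> A; apply: bopP => x; exact: add0r. Qed.
Fact bop_addN : left_inverse bop0 bopN bopD.
Proof. by move=> A; apply: bopP => x; exact: addNr. Qed.
HB.instance Definition _ := GRing.isZmodule.Build bop bop_addA bop_addC bop_add0 bop_addN.

Fact bop_mulA : associative bopM.
Proof. by move=> A B D; apply: bopP. Qed.
Fact bop_mul1 : left_id bop1 bopM.
Proof. by move=> A; apply: bopP. Qed.
Fact bop_mulr1 : right_id bop1 bopM.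
Proof. by move=> A; apply: bopP. Qed.
Fact bop_mulDl : left_distributive bopM +%R.
Proof. by move=> A B D; apply: bopP. Qed.
Fact bop_mulDr : right_distributive bopM +%R.
Proof.
by move=> A B D; apply: bopP => x; have := bop_linear A 1 (B x) (D x); rewrite !scale1r.
Qed.
HB.instance Definition _ := GRing.Zmodule_isPzRing.Build bop
  bop_mulA bop_mul1 bop_mulr1 bop_mulDl bop_mulDr.

(* The defining relation has at most one solution B, as [form] is definite. *)
Definition adjoint (A : bop) : bop :=
  xget 0 [set B : bop | forall x y, form (A x) y = form x (B y)].

End BoundedOperators.

Section FockOperators.
Variables (R : realType) (d : nat) (q : R) (hq : -1 < q < 1).
Notation C := R[i].
Local Notation fock := (fock_space d hq).
Local Notation bop := (bounded_op (@fdot R d q hq)).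

(* The elementary tensor v_1 (x) ... (x) v_n, where v = [:: v_1; ...; v_n]; the
   empty sequence gives the vacuum vector. *)
Definition etens_component (v : seq 'rV[C]_d) (n : nat) : tensor R d n :=
  if size v == n then tens (fun i : 'I_n => nth 0 v i) else 0.

Fact etens_summable v : summable_tensors q (etens_component v).
Proof.
apply/cvg_ex.
exists (series (fun n => Re (qdot q (etens_component v n) (etens_component v n))) (size v).+1).
apply: cvg_near_cst; exists (size v).+1 => // n /= hn.
rewrite -(subnKC hn) /series /= (big_cat_nat (n := (size v).+1)) //=; last exact: leq_addr.
rewrite [X in _ + X]big_nat [X in _ + X]big1 ?addr0 // => k /andP[hk _].
by rewrite /etens_component ltn_eqF // qdot0l.
Qed.

Arguments etens_summable : clear implicits.

Definition etens v : fock := @Fock R d q hq _ (etens_summable v).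

Definition vacuum : fock := etens [::].

Definition vacuum_state (X : bop) : C := fdot (X vacuum) vacuum.

(* The bounded operator determined by its values on elementary tensors, whose
   span is dense. *)
Definition left_creation (v : 'rV[C]_d) : bop :=
  xget 0 [set A : bop | forall s, A (etens s) = etens (v :: s)].

Definition right_creation (v : 'rV[C]_d) : bop :=
  xget 0 [set A : bop | forall s, A (etens s) = etens (rcons s v)].

Definition basis_vec (i : 'I_d) : 'rV[C]_d := delta_mx 0 i.

Definition T_op : bop :=
  \sum_(i < d) (left_creation (basis_vec i) + adjoint (left_creation (basis_vec i)))
             * (right_creation (basis_vec i) + adjoint (right_creation (basis_vec i))).
End FockOperators.

(* Main.v *)
(* On the q-Fock space put S_i = L_i + L_i^* and D_i = R_i + R_i^*. The operators
   L_i and R_j commute, and so do their adjoints, while the commutators [L_i^*, R_j]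
   and [R_j^*, L_i] coincide (both are delta_ij q^N, with N the number operator);
   hence every S_i commutes with every D_j, so that T is self-adjoint.

   As D_i and S_i agree on the vacuum, D_i S_u vac = S_(ui) vac for each word u, so
   T S_u vac is the sum of the S_(iui) vac and T^n vac is the sum over all words w
   of length n of S_(w rev(w)) vac. By the q-Wick formula, the vacuum expectation
   of S_(w rev(w)) is the sum of q^cr(pi) over the pair partitions pi of the 2n
   positions whose blocks are monochromatic for w rev(w). The colourings of the
   positions that are constant on the blocks of pi and of the rainbow are those
   constant on the blocks of the join, and there are d^|join| of them. *)
Require Import Defs.
From mathcomp Require Import all_boot all_order all_algebra all_fingroup.
From mathcomp Require Import complex reals zify ring lra.

Set Implicit Arguments.
Unset Strict Implicit.
Unset Printing Implicit Defensive.

Import Order.TTheory GRing.Theory Num.Theory.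
Local Open Scope complex_scope.
Local Open Scope ring_scope.

(** * Matchings, pair partitions and colourings *)

Section Matchings.
Local Open Scope nat_scope.
Variable m : nat.
Implicit Types (f g : 'S_m).

(** Fixed points are allowed: partial pairings occur while field operators are applied one by one to
    the vacuum. *)
Definition matching f := [forall x, f (f x) == x].

Lemma matchingP f : reflect (involutive f) (matching f).
Proof. exact: forallPP (fun=> eqP). Qed.

Definition complete_matching f := matching f && [forall x, f x != x].

Lemma complete_matchingP f :
  reflect (involutive f /\ forall x, f x != x) (complete_matching f).
Proof. by apply: (iffP andP) => -[/matchingP ? /forallP ?]. Qed.

(* A fixed point of [f] is an open point, to be joined later to a point on the left
   of all others; such an arc will cross every arc that covers the open point. *)
Definition arc_crossing f (a b : 'I_m) : bool :=
  [&& a < b, b < f a & (f b == b) || (f a < f b)].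

Definition crossing_number f : nat := \sum_a \sum_b arc_crossing f a b.

Definition open_points f := [seq x <- enum 'I_m | f x == x].

End Matchings.

(** * Adding one point on the left of a matching *)

Section AddArc.
Local Open Scope nat_scope.
Variable m : nat.
Implicit Types (g : 'S_m) (k : 'I_m).

(** The new leftmost point is sent to [k]: it stays open for [k = ord0], and is joined to [k] if [k]
    comes from an open point of [g]. The formula makes sense for all permutations, so that sums over
    all of ['S_m.+1] can be reindexed by it. *)
Definition add_arc g (k : 'I_m.+1) : 'S_m.+1 :=
  (lift_perm ord0 ord0 g * tperm ord0 k)%g.

Lemma add_arc0 g : add_arc g ord0 = lift_perm ord0 ord0 g.
Proof. by rewrite /add_arc tperm1 mulg1. Qed.

Lemma add_arc_ord0 g (k : 'I_m.+1) : add_arc g k ord0 = k.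
Proof. by rewrite permM lift_perm_id tpermL. Qed.

Lemma fix_eq g k x : g k = k -> (g x == k) = (x == k).
Proof. by move=> gk; rewrite -{1}gk (inj_eq perm_inj). Qed.

Lemma add_arc_lift g k x : g k = k ->
  add_arc g (lift ord0 k) (lift ord0 x) = if x == k then ord0 else lift ord0 (g x).
Proof.
move=> gk; rewrite permM lift_perm_lift; case: eqP => [->|/eqP xk].
  by rewrite gk tpermR.
by rewrite tpermD ?neq_lift // (inj_eq lift_inj) eq_sym fix_eq.
Qed.

(** Both sides have [(m+1)!] indices, so injectivity of [D] is enough. It is applied to [add_arc] in
    the Wick recursion and to [lift_perm] in the computation of adjoints. *)
Lemma sum_permS (V : nmodType) (D : 'S_m -> 'I_m.+1 -> 'S_m.+1) (F : 'S_m.+1 -> V) :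
  injective (uncurry D) -> (\sum_f F f = \sum_g \sum_(k < m.+1) F (D g k))%R.
Proof.
move=> Dinj; rewrite pair_bigA /= (reindex (uncurry D)) /=.
  by apply: eq_bigr => -[].
by apply/onW_bij/inj_card_bij; rewrite // card_prod !card_Sn card_ord factS mulnC.
Qed.

Lemma lift_perm_injective (i : 'I_m.+1) :
  injective (uncurry (fun g (k : 'I_m.+1) => lift_perm i k g)).
Proof.
move=> [g k] [h l] /= e.
have kl : k = l by rewrite -(lift_perm_id i k g) e lift_perm_id.
subst l; congr (_, _); apply/permP => x; apply: (@lift_inj _ k).
by rewrite -!(lift_perm_lift i) e.
Qed.

Lemma add_arc_injective : injective (uncurry add_arc).
Proof.
move=> [g k] [h l] /= e.
have kl : k = l by rewrite -(add_arc_ord0 g k) e add_arc_ord0.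
subst l; move/mulIg: e => e.
by have [->] := @lift_perm_injective ord0 (g, ord0) (h, ord0) e.
Qed.

Lemma matching_add_arc0 g : matching (add_arc g ord0) = matching g.
Proof.
rewrite add_arc0; apply/matchingP/matchingP => gK x.
  by apply: (@lift_inj _ ord0); rewrite -!(lift_perm_lift ord0) gK.
by have [y|] := unliftP ord0 x => ->; rewrite ?lift_perm_id ?lift_perm_lift ?gK.
Qed.

(** An involution that sends [ord0] to the lift of [k] must send it back, which happens exactly when
    [g] fixes [k]. *)
Lemma matching_add_arc g k :
  matching (add_arc g (lift ord0 k)) = (g k == k) && matching g.
Proof.
apply/idP/andP => [/matchingP fK|[/eqP gk /matchingP gK]].
  have gk : g k = k.
    have := fK ord0; rewrite add_arc_ord0 permM lift_perm_lift => e.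
    by apply: (@lift_inj _ ord0); apply: (@perm_inj _ (tperm ord0 (lift ord0 k)));
      rewrite e tpermR.
  rewrite gk eqxx; split=> //; apply/matchingP => x.
  have := fK (lift ord0 x); rewrite add_arc_lift //.
  case: eqP => [-> _|/eqP xk]; first by rewrite !gk.
  by rewrite add_arc_lift // fix_eq // (negbTE xk) => /lift_inj.
apply/matchingP => x; have [y|] := unliftP ord0 x => ->.
  rewrite add_arc_lift //; case: eqP => [->|/eqP yk]; first by rewrite add_arc_ord0.
  by rewrite add_arc_lift // fix_eq // (negbTE yk) gK.
by rewrite add_arc_ord0 add_arc_lift // eqxx.
Qed.

Lemma arc_crossing_lift g (a b : 'I_m) :
  arc_crossing (lift_perm ord0 ord0 g) (lift ord0 a) (lift ord0 b) = arc_crossing g a b.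
Proof. by rewrite /arc_crossing !lift_perm_lift (inj_eq lift_inj). Qed.

Lemma crossing_number_add_arc0 g : crossing_number (add_arc g ord0) = crossing_number g.
Proof.
rewrite add_arc0 /crossing_number big_ord_recl big1 => [|b _]; last first.
  by rewrite /arc_crossing lift_perm_id andbF.
apply: eq_bigr => a _; rewrite big_ord_recl {1}/arc_crossing /= add0n.
by apply: eq_bigr => b _; rewrite arc_crossing_lift.
Qed.

(* The arc from the new leftmost point to [k] crosses the old arcs that covered
   the formerly open point [k], and covers the open points to the left of [k]. *)
Lemma crossing_number_add_arc g k : matching g -> g k = k ->
  crossing_number (add_arc g (lift ord0 k)) =
    crossing_number g + count (fun b : 'I_m => b < k) (open_points g).
Proof.
move=> /matchingP gK gk; set f := add_arc g _.
(* The new arc meets the open points to the left of [k] and the arcs that cover [k]. *)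
have row0 (b : 'I_m) : nat_of_bool (arc_crossing f ord0 (lift ord0 b)) =
    ((b < k) && (g b == b)) + ((b < k) && (k < g b)).
  rewrite /arc_crossing add_arc_ord0 add_arc_lift //= /bump /= !add1n !ltnS.
  case: (b =P k) => [->|bk]; first by rewrite ltnn.
  rewrite (inj_eq lift_inj) /= /bump /= add1n ltnS.
  by case: ltnP => //= bk'; case: eqP => [->|_] //; rewrite [k < b]ltnNge ltnW.
(* An arc from [a] that covers the open point [k] was already counted in [g]; this term leaves the
   row of [a] and is recovered in the row of [ord0], so only the open points contribute to the
   increase. *)
have rowS (a : 'I_m) : \sum_b arc_crossing g a b =
    \sum_(b < m.+1) arc_crossing f (lift ord0 a) b + ((a < k) && (k < g a)).
  rewrite big_ord_recl /= add0n (bigD1 k) //= addnC; congr (_ + _); last first.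
    by rewrite /arc_crossing gk eqxx /= andbT.
  rewrite [RHS](bigD1 k) //= [arc_crossing f _ (lift ord0 k)]/arc_crossing.
  rewrite [f (lift ord0 k)]add_arc_lift // eqxx ltn0 !andbF add0n.
  apply: eq_bigr => b bk; rewrite /arc_crossing !add_arc_lift // (negbTE bk).
  case: (a =P k) => [->|ak]; last by rewrite (inj_eq lift_inj) /= /bump !add1n !ltnS.
  by rewrite gk ltn0 !andbF; case: ltngtP.
have countE : count (fun b : 'I_m => b < k) (open_points g) =
    \sum_(b < m) ((b < k) && (g b == b)).
  rewrite -sum1_count big_filter_cond big_enum_cond big_mkcond /=.
  by apply: eq_bigr => b _; rewrite andbC; case: (_ && _).
rewrite /crossing_number big_ord_recl big_ord_recl /= add0n countE.
under eq_bigr => b _ do rewrite row0.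
under [in RHS]eq_bigr => a _ do rewrite rowS.
by rewrite !big_split /= [LHS]addnC -addnA; congr (_ + _); rewrite addnC.
Qed.

Lemma open_points_add_arc0 g :
  open_points (add_arc g ord0) = ord0 :: map (lift ord0) (open_points g).
Proof.
rewrite /open_points enum_ordSl /= add_arc0 lift_perm_id eqxx; congr (_ :: _).
rewrite filter_map; congr map; apply: eq_filter => x /=.
by rewrite lift_perm_lift (inj_eq lift_inj).
Qed.

Lemma open_points_add_arc g k : g k = k ->
  open_points (add_arc g (lift ord0 k)) = map (lift ord0) (rem k (open_points g)).
Proof.
move=> gk; rewrite /open_points enum_ordSl /= add_arc_ord0 /=.
rewrite rem_filter; last by rewrite filter_uniq // enum_uniq.
rewrite -filter_predI filter_map; congr map; apply: eq_filter => x /=.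
by rewrite add_arc_lift //; case: (x =P k) => //= _; rewrite (inj_eq lift_inj).
Qed.

End AddArc.

(** * Pair partitions as fixed-point-free involutions, and their joins *)

Section Arcs.
Local Open Scope nat_scope.
Variable n : nat.
Implicit Types (f g : 'S_(2 * n)) (P : {set {set 'I_(2 * n)}}).

Definition arcs f : {set {set 'I_(2 * n)}} := [set [set x; f x] | x : 'I_(2 * n)].

Lemma arcs_block f x B : involutive f -> B \in arcs f -> x \in B -> B = [set x; f x].
Proof.
move=> fK /imsetP[y _ ->]; rewrite !inE => /orP[/eqP -> //|/eqP ->].
by rewrite fK setUC.
Qed.

Lemma pair_partition_arcs f : complete_matching f -> pair_partition (arcs f).
Proof.
move=> /complete_matchingP[fK fx]; apply/andP; split; last first.
  by apply/forall_inP => B /imsetP[x _ ->]; rewrite cards2 [x == _]eq_sym fx.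
apply/and3P; split.
- apply/eqP/setP => x; rewrite inE; apply/bigcupP; exists [set x; f x].
    exact: imset_f.
  by rewrite !inE eqxx.
- apply/trivIsetP => B D Bf Df; apply: contraR => /pred0Pn[x /andP[xB xD]].
  by rewrite (arcs_block fK Bf xB) (arcs_block fK Df xD).
- by apply/imsetP => -[x _ /setP/(_ x)]; rewrite !inE eqxx.
Qed.

Lemma arcs_inj : {in @complete_matching (2 * n) &, injective arcs}.
Proof.
move=> f g /complete_matchingP[fK fx] /complete_matchingP[gK gx] e.
apply/permP => x; have: [set x; f x] \in arcs g by rewrite -e; apply: imset_f.
move=> /(arcs_block gK)/(_ (set21 _ _))/setP/(_ (f x)).
by rewrite !inE eqxx orbT (negbTE (fx x)) => /esym/eqP.
Qed.

(** The matching sends each point to the other point of its block. *)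
Lemma pair_partition_matching P : pair_partition P ->
  exists2 f, complete_matching f & P = arcs f.
Proof.
case/andP => PT /forall_inP P2; have [/eqP cP tP P0] := and3P PT.
have blkP x : pblock P x \in P by rewrite pblock_mem // cP inE.
have xblk x : x \in pblock P x by rewrite mem_pblock cP inE.
have /fin_all_exists[f fP] x : exists y, (y != x) /\ pblock P x = [set x; y].
  have /eqP/cards1P[y] : #|pblock P x :\ x| = 1.
    by have := P2 _ (blkP x); rewrite (cardsD1 x) xblk => /eqP[].
  move=> e; exists y; have: y \in pblock P x :\ x by rewrite e set11.
  by rewrite in_setD1 => /andP[-> _]; rewrite -e setD1K.
have fK : involutive f.
  move=> x; have e : pblock P (f x) = pblock P x.
    by apply: same_pblock; rewrite // (fP x).2 set22.
  have: x \in pblock P (f x) by rewrite e.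
  rewrite (fP (f x)).2 !inE eq_sym (negbTE (fP x).1) /= => /eqP //.
have fE x : perm (inv_inj fK) x = f x by rewrite permE.
exists (perm (inv_inj fK)).
  by apply/complete_matchingP; split=> x; rewrite !fE // (fP x).1.
apply/setP => B; apply/idP/imsetP => [BP|[x _ ->]]; last by rewrite fE -(fP x).2.
have /card_gt0P[x xB] : 0 < #|B| by rewrite (eqP (P2 B BP)).
by exists x; rewrite // fE -(fP x).2; apply/esym/def_pblock.
Qed.

(** A crossing pair of blocks is encoded by its two left ends [a < b], with [a < b < f a < f b]; the
    clause of [arc_crossing] about open points never applies here. *)
Lemma cr_arcs f : complete_matching f -> cr (arcs f) = crossing_number f.
Proof.
move=> /complete_matchingP[fK fx].
pose A := [set p : 'I_(2 * n) * 'I_(2 * n) | arc_crossing f p.1 p.2].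
have -> : crossing_number f = #|A|.
  rewrite /crossing_number pair_bigA /= -sum1_card [RHS]big_mkcond /=.
  by apply: eq_bigr => p _; rewrite inE; case: arc_crossing.
pose E (p : 'I_(2 * n) * 'I_(2 * n)) := [set [set p.1; f p.1]; [set p.2; f p.2]].
have ltP a b : arc_crossing f a b -> [/\ a < b, b < f a & f a < f b].
  by rewrite /arc_crossing (negbTE (fx b)) => /and3P.
have blkE a b : ([set a; f a] == [set b; f b]) = (b == a) || (b == f a).
  apply/eqP/orP => [e|[/eqP -> //|/eqP ->]]; last by rewrite fK setUC.
  by have: b \in [set a; f a] by [rewrite e set21]; rewrite !inE => /orP.
have injE : {in A &, injective E}.
  move=> [a b] [c e]; rewrite !inE /= => /ltP[ab bfa fab] /ltP[ce efc fce] Ee.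
  have h1 : [set a; f a] \in E (c, e) by rewrite -Ee set21.
  have h2 : [set b; f b] \in E (c, e) by rewrite -Ee set22.
  have nat_eq x y : [set x; f x] == [set y; f y] ->
      (y = x :> nat /\ f y = f x :> nat) \/ (y = f x :> nat /\ f y = x :> nat).
    by rewrite blkE => /orP[]/eqP ->; [left|right; rewrite fK].
  move: h1 h2; rewrite !inE /=.
  (* Of the four ways to match the blocks of the two pairs, the order of the end points leaves only
     the identical one. *)
  move=> /orP[]/nat_eq h1 /orP[]/nat_eq h2.
  - by exfalso; lia.
  - by congr (_, _); apply: val_inj; rewrite /=; lia.
  - by exfalso; lia.
  - by exfalso; lia.
rewrite -(card_in_imset injE) /cr; apply: eq_card => X; rewrite !inE.
apply/idP/imsetP => [/exists_inP[B Bf /exists_inP[D Df]]|[[a b]]].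
  move=> /and3P[BD /eqP -> crBD].
  wlog iBD : B D Bf Df BD {crBD} / interlaced B D => [thesis|].
    case/orP: crBD => h; first exact: thesis h.
    by rewrite setUC; apply: thesis h; rewrite // eq_sym.
  have /existsP[a /existsP[b /existsP[c /existsP[e]]]] := iBD.
  move=> /and5P[ab bc ce /eqP Bac /eqP Dbe].
  have fE x y : [set x; y] \in arcs f -> x < y -> f x = y.
    move=> /(arcs_block fK)/(_ (set21 _ _))/setP/(_ y); rewrite !inE eqxx orbT.
    by move=> /esym/orP[/eqP ->|/eqP -> //]; rewrite ltnn.
  have fa : f a = c by apply: fE; [rewrite -Bac | lia].
  have fb : f b = e by apply: fE; [rewrite -Dbe | lia].
  exists (a, b); last by rewrite /E /= fa fb -Bac -Dbe.
  by rewrite inE /arc_crossing /= fa fb ab bc ce orbT.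
rewrite inE /= => /ltP[ab bfa fab] ->.
apply/exists_inP; exists [set a; f a]; first exact: imset_f.
apply/exists_inP; exists [set b; f b]; first exact: imset_f.
apply/and3P; split=> //.
  rewrite blkE; apply/norP; split; apply/eqP => e; move: ab bfa; rewrite e; lia.
apply/orP; left; apply/existsP; exists a; apply/existsP; exists b.
by apply/existsP; exists (f a); apply/existsP; exists (f b); rewrite ab bfa fab !eqxx.
Qed.

Lemma card_pair_partition P : pair_partition P -> #|P| = n.
Proof.
case/andP => PT /forall_inP P2; have := card_uniform_partition (n := 2) _ PT.
rewrite cardsT card_ord => /(_ (fun B BP => eqP (P2 B BP))); lia.
Qed.

(** There are only ['C(n, 2)] pairs of blocks. Hence the upper limit for the crossings in [Qtilde]
    loses nothing. *)
Lemma cr_le P : pair_partition P -> cr P <= n ^ 2 - n.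
Proof.
move=> /card_pair_partition cP; apply: (@leq_trans 'C(n, 2)); last first.
  by rewrite bin2 -mulnn; nia.
have <- : 'C(#|P|, 2) = 'C(n, 2) by rewrite cP.
rewrite -cards_draws; apply/subset_leq_card/subsetP => E; rewrite !inE.
move=> /exists_inP[B BP /exists_inP[D DP /and3P[BD /eqP -> _]]].
by rewrite cards2 BD subUset !sub1set BP DP.
Qed.

Definition rev_perm : 'S_(2 * n) := perm rev_ord_inj.

Lemma complete_matching_rev : complete_matching rev_perm.
Proof.
apply/complete_matchingP; split=> x; first by rewrite !permE rev_ordK.
apply/eqP => /(congr1 val); rewrite permE /=; have := ltn_ord x; lia.
Qed.

Lemma rainbow_arcs : rainbow n = arcs rev_perm.
Proof. by apply: eq_imset => x; rewrite permE. Qed.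

Lemma cr_rainbow : cr (rainbow n) = 0.
Proof.
rewrite rainbow_arcs cr_arcs ?complete_matching_rev //.
rewrite /crossing_number big1 // => a _; rewrite big1 // => b _.
apply/eqP; rewrite eqb0; apply/negP => /and3P[ab _].
rewrite (negbTE ((complete_matchingP _ complete_matching_rev).2 _)) !permE /=.
have := ltn_ord a; have := ltn_ord b; lia.
Qed.

Implicit Types J K : {set {set 'I_(2 * n)}}.

Lemma refinesP P J : partition P [set: 'I_(2 * n)] -> partition J [set: 'I_(2 * n)] ->
  reflect (forall x y, y \in pblock P x -> pblock J x = pblock J y) (refines P J).
Proof.
move=> /and3P[/eqP cP tP P0] /and3P[/eqP cJ tJ J0].
apply: (iffP forall_inP) => [PJ x y yx|h B BP].
  have xcP : x \in cover P by rewrite cP inE.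
  have /exists_inP[D DJ /subsetP xD] := PJ _ (pblock_mem xcP).
  rewrite (def_pblock tJ DJ (xD x _)) ?mem_pblock //.
  by rewrite (def_pblock tJ DJ (xD y _)).
have [B0|[x xB]] := set_0Vmem B; first by rewrite B0 (negbTE P0) in BP.
apply/exists_inP; exists (pblock J x); first by rewrite pblock_mem // cJ inE.
apply/subsetP => y yB; rewrite (h x y) ?mem_pblock ?cJ ?inE //.
by rewrite (def_pblock tP BP xB).
Qed.

(** The join consists of the connected components of the relation of sharing a block of [P] or of
    [K]. A common coarsening identifies the ends of each edge, hence those of each path. *)
Lemma is_join_exists P K : partition P [set: 'I_(2 * n)] ->
  partition K [set: 'I_(2 * n)] -> exists J, is_join P K J.
Proof.
move=> PT KT.
pose e := [rel x y | (y \in pblock P x) || (y \in pblock K x)].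
have pbsym Q x y : partition Q [set: 'I_(2 * n)] ->
    (y \in pblock Q x) = (x \in pblock Q y).
  move=> /and3P[/eqP cQ tQ _].
  by rewrite -!eq_pblock ?cQ ?inE // eq_sym.
have esym : connect_sym e.
  by apply: sym_connect_sym => x y /=; rewrite (pbsym P) // (pbsym K).
have eqv : {in [set: 'I_(2 * n)] & &, equivalence_rel (connect e)}.
  move=> x y z _ _ _; split; first exact: connect0.
  by move=> xy; apply: (same_connect esym).
exists (equivalence_partition (connect e) [set: 'I_(2 * n)]).
have JT := equivalence_partitionP eqv.
have pbJ x y : connect e x y ->
   pblock (equivalence_partition (connect e) [set: 'I_(2 * n)]) x =
   pblock (equivalence_partition (connect e) [set: 'I_(2 * n)]) y.
  move=> xy; have /and3P[/eqP cJ tJ _] := JT.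
  by apply/eqP; rewrite eq_pblock ?cJ ?inE // pblock_equivalence_partition ?inE.
apply/and4P; split=> //.
- by apply/refinesP => // x y h; apply/pbJ/connect1; rewrite /= h.
- by apply/refinesP => // x y h; apply/pbJ/connect1; rewrite /= h orbT.
apply/forall_inP => Q /and3P[QT /refinesP PQ /refinesP KQ].
apply/refinesP => // x y; rewrite pblock_equivalence_partition ?inE //.
case/connectP => p; elim: p x => [|z p IHp] x /=; first by move=> _ ->.
case/andP => /orP[xz|xz] zp /(IHp _ zp) <-; [exact: PQ|exact: KQ].
Qed.

Lemma partition_joinP P K : partition P [set: 'I_(2 * n)] ->
  partition K [set: 'I_(2 * n)] -> is_join P K (partition_join P K).
Proof.
move=> PT KT; rewrite /partition_join; case: pickP => //= no.
by have [J] := is_join_exists PT KT; rewrite no.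
Qed.

(** Sending a block of [K] to the block of the join that contains it is onto, and [K] has [n]
    blocks. *)
Lemma card_join_le P K : partition P [set: 'I_(2 * n)] -> pair_partition K ->
  #|partition_join P K| <= n.
Proof.
move=> PT KK; have KT : partition K [set: 'I_(2 * n)] by case/andP: KK.
have /and4P[JT _ KJ _] := partition_joinP PT KT.
set J := partition_join P K in JT KJ *.
apply: (@leq_trans #|K|); last by rewrite (card_pair_partition KK).
have [/and3P[/eqP cK tK _] /and3P[/eqP cJ tJ J0]] := (KT, JT).
pose above (B : {set 'I_(2 * n)}) := odflt set0 [pick D in J | B \subset D].
apply: leq_trans (leq_imset_card above K).
apply/subset_leq_card/subsetP => D DJ.
have [D0|[x xD]] := set_0Vmem D; first by rewrite -D0 DJ in J0.
have xK : x \in cover K by rewrite cK inE.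
apply/imsetP; exists (pblock K x); first exact: pblock_mem.
have xx : x \in pblock K x by rewrite mem_pblock.
have /exists_inP[E EJ xE] := forall_inP KJ _ (pblock_mem xK).
rewrite /above; case: pickP => [F /andP[FJ /subsetP/(_ _ xx) xF]|/(_ E)] /=.
  by rewrite -(def_pblock tJ DJ xD) (def_pblock tJ FJ xF).
by rewrite EJ xE.
Qed.

Lemma card_join_gt0 P K : 0 < n -> partition P [set: 'I_(2 * n)] ->
  partition K [set: 'I_(2 * n)] -> 0 < #|partition_join P K|.
Proof.
move=> n0 PT KT; have /and4P[/and3P[/eqP cJ _ _] _ _ _] := partition_joinP PT KT.
have n2 : 0 < 2 * n by rewrite muln_gt0.
apply/card_gt0P; exists (pblock (partition_join P K) (Ordinal n2)).
by rewrite pblock_mem // cJ inE.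
Qed.

Lemma card_constant_colorings (d : nat) J : 0 < d -> partition J [set: 'I_(2 * n)] ->
  #|[set c : {ffun 'I_(2 * n) -> 'I_d} |
     [forall x, forall y, (y \in pblock J x) ==> (c x == c y)]]| = d ^ #|J|.
Proof.
move=> d0 /and3P[/eqP cJ tJ J0]; pose i0 : 'I_d := Ordinal d0.
pose h (b : {ffun {set 'I_(2 * n)} -> 'I_d}) : {ffun 'I_(2 * n) -> 'I_d} :=
    [ffun x => b (pblock J x)].
(* Colourings of the blocks are functions on all subsets with the default value [i0] off [J];
   composing them with [pblock J] gives the colourings to be counted. *)
have -> : d ^ #|J| = #|pffun_on i0 (mem J) predT|.
  by rewrite card_pffun_on cardT size_enum_ord.
have blk D : D \in J -> exists x, D = pblock J x.
  move=> DJ; have [D0|[x xD]] := set_0Vmem D; first by rewrite -D0 DJ in J0.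
  by exists x; rewrite (def_pblock tJ DJ xD).
have injh : {in pffun_on i0 (mem J) predT &, injective h}.
  move=> b b' /pffun_onP[/subsetP sb _] /pffun_onP[/subsetP sb' _] e.
  apply/ffunP => D; have [/blk[x ->]|DJ] := boolP (D \in J).
    by move/ffunP: e => /(_ x); rewrite !ffunE.
  have off c : {subset i0.-support c <= mem J} -> c D = i0.
    by move=> sc; apply/eqP; apply: contraR DJ; apply: sc.
  by rewrite (off b) // (off b').
rewrite -(card_in_imset injh); apply: eq_card => c; rewrite inE.
apply/idP/imsetP => [/forallP cc|[b _ ->]].
  pose r D := odflt i0 [pick i | [exists x, (D == pblock J x) && (i == c x)]].
  exists [ffun D : {set 'I_(2 * n)} => if D \in J then r D else i0].
    apply/pffun_onP; split=> //; apply/subsetP => D; rewrite inE ffunE.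
    by case: ifP => //; rewrite eqxx.
  apply/ffunP => x; rewrite !ffunE pblock_mem ?cJ ?inE // /r.
  case: pickP => [i /existsP[y /andP[/eqP e /eqP ->]]|/(_ (c x)) /existsP[]] /=.
    apply/eqP; apply: (implyP (forallP (cc x) y)).
    by rewrite e mem_pblock cJ inE.
  by exists x; rewrite !eqxx.
apply/forallP => x; apply/forallP => y; apply/implyP => yx; rewrite !ffunE.
by rewrite (same_pblock tJ yx).
Qed.

(** If [c] is constant on the blocks of [P] and of [K], both refine the partition into level sets of
    [c]; by minimality so does the join. *)
Lemma card_join_colorings (d : nat) P K : 0 < d -> partition P [set: 'I_(2 * n)] ->
  partition K [set: 'I_(2 * n)] ->
  #|[set c : {ffun 'I_(2 * n) -> 'I_d} |
     [forall x, forall y, (y \in pblock P x) || (y \in pblock K x) ==> (c x == c y)]]|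
  = d ^ #|partition_join P K|.
Proof.
move=> d0 PT KT; have /and4P[JT PJ KJ Jmin] := partition_joinP PT KT.
set J := partition_join P K in JT PJ KJ Jmin *.
have /and3P[/eqP cJ tJ J0] := JT.
rewrite -card_constant_colorings //; apply: eq_card => c; rewrite !inE.
apply/idP/idP => /forallP cc; apply/forallP => x; apply/forallP => y.
  have eqv : {in [set: 'I_(2 * n)] & &, equivalence_rel (fun x y => c x == c y)}.
    by move=> u v w _ _ _; split=> // /eqP ->.
  have QT := equivalence_partitionP eqv.
  set Q := equivalence_partition _ _ in QT.
  have [/and3P[/eqP cQ tQ _]] := QT.
  have Qeq u v : (pblock Q u == pblock Q v) = (c u == c v).
    by rewrite eq_pblock ?cQ ?inE // pblock_equivalence_partition ?inE.
  have /(refinesP JT QT) JQ : refines J Q.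
    apply: (implyP (forallP Jmin Q)); rewrite QT /=.
    apply/andP; split; apply/refinesP => // u v uv; apply/eqP; rewrite Qeq;
      by apply: (implyP (forallP (cc u) v)); rewrite uv ?orbT.
  by apply/implyP => /JQ/eqP; rewrite Qeq.
apply/implyP => h; apply: (implyP (forallP (cc x) y)).
rewrite -eq_pblock ?cJ ?inE //; apply/eqP.
by case/orP: h; [exact: (refinesP PT JT PJ)|exact: (refinesP KT JT KJ)].
Qed.

Lemma card_arcs_colorings (d : nat) f g : 0 < d ->
  complete_matching f -> complete_matching g ->
  #|[set c : {ffun 'I_(2 * n) -> 'I_d} |
     [forall x, c (f x) == c x] && [forall x, c (g x) == c x]]|
  = d ^ #|partition_join (arcs f) (arcs g)|.
Proof.
move=> d0 fc gc.
have [/andP[fT _] /andP[gT _]] := (pair_partition_arcs fc, pair_partition_arcs gc).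
rewrite -card_join_colorings //; apply: eq_card => c; rewrite !inE.
have blk h x y : complete_matching h ->
    (y \in pblock (arcs h) x) = (y == x) || (y == h x).
  move=> hc; have /andP[/and3P[_ tP _] _] := pair_partition_arcs hc.
  have hx : [set x; h x] \in arcs h by apply: imset_f.
  by rewrite (def_pblock tP hx) ?set21 ?inE.
apply/andP/forallP => [[/forallP cf /forallP cg] x|cc].
  apply/forallP => y; apply/implyP; rewrite !blk //.
  by move=> /orP[]/orP[]/eqP ->; rewrite // eq_sym.
by split; apply/forallP => x; rewrite eq_sym; apply: (implyP (forallP (cc x) _));
  rewrite !blk // eqxx !orbT.
Qed.

(** After exchanging sums, each pair partition contributes at a single [(k, l)], which lies in the
    range of [Qtilde]: its join with the rainbow has between [1] and [n] blocks, and [cr_le] bounds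
    [l]. Then [arcs] reindexes the sum by matchings. *)
Lemma Qtilde_matchings (R : pzRingType) (t u : R) : 0 < n ->
  (Qtilde n t u = \sum_(f | complete_matching f)
     t ^+ #|partition_join (arcs f) (rainbow n)| * u ^+ crossing_number f)%R.
Proof.
move=> n0; have rc := complete_matching_rev.
have rP : pair_partition (rainbow n) by rewrite rainbow_arcs; apply: pair_partition_arcs.
have [rT _] := andP rP.
pose S := [set P : {set {set 'I_(2 * n)}} | pair_partition P].
transitivity (\sum_(P in S) t ^+ #|partition_join P (rainbow n)| * u ^+ cr P)%R.
  pose w (P : {set {set 'I_(2 * n)}}) := #|partition_join P (rainbow n)|.
  have countE k l : rainbow_count n k l = \sum_(P in S) ((w P == k) && (cr P == l)).
    rewrite /rainbow_count -sum1_card.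
    transitivity (\sum_(P in [set P in S | (w P == k) && (cr P == l)]) 1).
      have inj : injective (fun P : {set {set 'I_(2 * n)}} => (P, rainbow n)).
        by move=> P K [].
      rewrite !sum1_card -(card_imset _ inj); apply: eq_card => -[P K]; rewrite !inE /=.
      apply/and4P/imsetP => [[/andP[/= PP _] /eqP -> wk crl]|[P']].
        exists P => //; rewrite !inE PP [w P == k]wk /=.
        by move: crl; rewrite /crossings /= cr_rainbow addn0.
      rewrite !inE => /and3P[PP wk crl] [-> ->].
      by rewrite /meandric_system /crossings /= PP rP cr_rainbow addn0.
    rewrite big_mkcond [RHS]big_mkcond /=; apply: eq_bigr => P _.
    by rewrite !inE; case: pair_partition => //=; case: (_ && _).
  rewrite /Qtilde.
  under eq_bigr => k _ do under eq_bigr => l _ do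
    rewrite countE -mulrA natr_sum mulr_suml.
  under eq_bigr => k _ do rewrite exchange_big /=.
  rewrite exchange_big /=; apply: eq_bigr => P; rewrite inE => PP.
  have [PT _] := andP PP.
  have wP : 0 < w P <= n by rewrite card_join_gt0 // card_join_le.
  rewrite (bigD1_seq (w P)) ?mem_index_iota ?iota_uniq //= [X in (_ + X)%R]big1.
    rewrite addr0 (bigD1_seq (cr P)) ?mem_index_iota ?iota_uniq ?ltnS ?cr_le //=.
    rewrite !eqxx mul1r big1 ?addr0 // => l /negbTE; rewrite eq_sym => ->.
    by rewrite mul0r.
  move=> k /negbTE kw; rewrite big1 // => l _; rewrite eq_sym kw mul0r //.
have -> : S = arcs @: [set f | complete_matching f].
  apply/setP => P; rewrite inE; apply/idP/imsetP => [PP|[f]].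
    by have [f fc ->] := pair_partition_matching PP; exists f; rewrite ?inE.
  by rewrite inE => fc ->; apply: pair_partition_arcs.
rewrite big_imset /=; last by move=> f g; rewrite !inE; apply: arcs_inj.
by apply: eq_big => [f|f]; rewrite inE // => fc; rewrite cr_arcs.
Qed.

End Arcs.

(* Loaded only now, because [classical_sets] redefines [partition]. *)
From mathcomp Require Import boolp classical_sets functions topology.
From mathcomp Require Import normedtype sequences.
Import numFieldNormedType.Exports.
Local Open Scope complex_scope.
Local Open Scope ring_scope.

Local Notation Re := complex.Re.
Local Notation Im := complex.Im.

(** * Creation and annihilation operators *)

Section LiftPermInversions.
Local Open Scope nat_scope.
Variable n : nat.
Implicit Types (t : 'S_n) (k : 'I_n.+1).

Lemma inversions_sum m (t : 'S_m) :
  inversions t = \sum_(a < m) \sum_(b < m) ((a < b) && (t b < t a)).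
Proof.
rewrite pair_bigA /= /inversions -sum1_card big_mkcond /=.
by apply: eq_bigr => p _; rewrite inE; case: (_ && _).
Qed.

Lemma ltn_lift k (a b : 'I_n) : (lift k a < lift k b) = (a < b).
Proof. by rewrite !ltnNge /= leq_bump2. Qed.

(** The three terms count the inversions whose left position is [i], those whose right position is
    [i], and those that avoid [i]. *)
Lemma inversions_lift_perm (i k : 'I_n.+1) t :
  inversions (lift_perm i k t) =
    \sum_(b < n) ((i < lift i b) && (lift k (t b) < k)) +
    \sum_(a < n) ((lift i a < i) && (k < lift k (t a))) + inversions t.
Proof.
rewrite !inversions_sum (bigD1_ord i) //= (bigD1_ord i) //= ltnn add0n -addnA.
congr (_ + _).
  by apply: eq_bigr => b _; rewrite lift_perm_id lift_perm_lift.
rewrite -big_split /=; apply: eq_bigr => a _; rewrite (bigD1_ord i) //=.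
congr (_ + _); first by rewrite lift_perm_id lift_perm_lift.
by apply: eq_bigr => b _; rewrite !lift_perm_lift !ltn_lift.
Qed.

(** In first position, the value [k] is inverted with each of the [k] smaller values. *)
Lemma inversions_lift_perm0 k t : inversions (lift_perm ord0 k t) = k + inversions t.
Proof.
rewrite inversions_lift_perm [X in _ + X + _]big1 // addn0; congr (_ + _).
(* Summing over values instead of positions removes [t] from the count. *)
rewrite (reindex_inj (@perm_inj _ t^-1)) /=.
under eq_bigr => b _ do rewrite permKV.
have kn : k <= n by rewrite -ltnS.
transitivity (\sum_(b < n | b < k) 1).
  rewrite [RHS]big_mkcond; apply: eq_bigr => b _ /=.
  by rewrite /bump; case: (leqP k b) => h; rewrite ?add0n ?add1n ?h // ltnNge leqW.
by rewrite -(big_ord_widen _ (fun=> 1) kn) sum1_card card_ord.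
Qed.

(** In last position, the value [k] is inverted with each of the [n - k] larger values. *)
Lemma inversions_lift_perm_max k t :
  inversions (lift_perm ord_max k t) = (n - k) + inversions t.
Proof.
rewrite inversions_lift_perm big1 ?add0n; last first.
  by move=> b _; rewrite lift_max ltnNge ltnW.
congr (_ + _); rewrite (reindex_inj (@perm_inj _ t^-1)) /=.
under eq_bigr => b _ do rewrite permKV.
have kn : k <= n by rewrite -ltnS.
transitivity (\sum_(b < n) (1 - (b < k))).
  apply: eq_bigr => b _; rewrite /= /bump; have := ltn_ord (t^-1%g b).
  lia.
rewrite sumnB => [|b _]; last by case: (_ < _).
rewrite sum1_card card_ord; congr (_ - _).
transitivity (\sum_(b < n | b < k) 1).
  by rewrite [RHS]big_mkcond; apply: eq_bigr => b _ /=; case: (_ < _).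
by rewrite -(big_ord_widen _ (fun=> 1) kn) sum1_card card_ord.
Qed.
End LiftPermInversions.

(** * Creation and annihilation on the tensor powers *)

Section Creation.
Variables (R : realType) (d : nat) (q : R).
Notation C := R[i].
Local Notation word := (word d).
Local Notation tensor := (tensor R d).
Local Notation qC := (q%:C : C).
Implicit Types (i j : 'I_d).

Definition insert_letter n (k : 'I_n.+1) i (w : word n) : word n.+1 :=
  [ffun l => if unlift k l is Some l' then w l' else i].

Definition delete_letter n (k : 'I_n.+1) (w : word n.+1) : word n :=
  [ffun l => w (lift k l)].

Lemma insert_letter_at n k i (w : word n) : insert_letter k i w k = i.
Proof. by rewrite ffunE unlift_none. Qed.

Lemma insert_letter_lift n k i (w : word n) l : insert_letter k i w (lift k l) = w l.
Proof. by rewrite ffunE liftK. Qed.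

Lemma insert_letterK n k i : cancel (@insert_letter n k i) (delete_letter k).
Proof. by move=> w; apply/ffunP => l; rewrite ffunE insert_letter_lift. Qed.

Lemma delete_letterK n k (w : word n.+1) : insert_letter k (w k) (delete_letter k w) = w.
Proof.
apply/ffunP => l; have [l'|] := unliftP k l => ->; last by rewrite insert_letter_at.
by rewrite insert_letter_lift ffunE.
Qed.

(** One definition serves both sides: [p] is [ord0] for left and [ord_max] for right creation. *)
Definition create n (p : 'I_n.+1) i (x : tensor n) : tensor n.+1 :=
  [ffun s : word n.+1 => (s p == i)%:R * x (delete_letter p s)].

(** On a basis tensor, this sums over the occurrences of the letter [i], removing the one at
    position [k] with weight [q ^ c k]. *)
Definition annihilate n (c : 'I_n.+1 -> nat) i (y : tensor n.+1) : tensor n :=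
  [ffun s : word n => \sum_(k < n.+1) qC ^+ c k * y (insert_letter k i s)].

Fact create_linear n p i : linear (@create n p i).
Proof. by move=> a x y; apply/ffunP => s; rewrite !ffunE mulrDr mulrCA. Qed.

Fact annihilate_linear n c i : linear (@annihilate n c i).
Proof.
move=> a x y; apply/ffunP => s; rewrite !ffunE scaler_sumr -big_split /=.
by apply: eq_bigr => k _; rewrite !ffunE mulrDr mulrCA.
Qed.

Lemma conj_qXM m (z : C) : (qC ^+ m * z)^* = qC ^+ m * z^*.
Proof. by rewrite rmorphM rmorphXn; congr (_ ^+ _ * _); exact: conjc_real. Qed.

(** The permutations in [qdot] are sorted by the image [k] of [p]. The created letter is then paired
    with the letter of [y] at [k], at the cost of [c k] inversions. *)
Lemma qdot_create n (p : 'I_n.+1) (c : 'I_n.+1 -> nat) i x y :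
  (forall k t, inversions (lift_perm p k t) = c k + inversions t)%N ->
  qdot q (create p i x) y = qdot q x (annihilate c i y).
Proof.
move=> hc; rewrite !qdotE (sum_permS _ (@lift_perm_injective _ p)) /=.
apply: eq_bigr => t _.
transitivity (\sum_(k < n.+1) \sum_(w : word n) qC ^+ inversions t *
    (x (wperm t w) * (qC ^+ c k * y (insert_letter k i w))^*)); last first.
  rewrite exchange_big mulr_sumr; apply: eq_bigr => w _.
  by rewrite ffunE rmorph_sum !mulr_sumr.
apply: eq_bigr => k _; rewrite hc exprD.
rewrite (bigID (fun s : word n.+1 => s k == i)) /= [X in _ + X]big1 => [|s sk].
  (* The words with the letter [i] at [k] are exactly the insertions of [i] at [k]. *)
  rewrite addr0 (reindex_onto (insert_letter k i) (delete_letter k)) /=; last first.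
    by move=> s /eqP <-; rewrite delete_letterK.
  rewrite mulr_sumr; apply: eq_big => [w|w _].
    by rewrite insert_letter_at eqxx insert_letterK eqxx.
  rewrite [create p i x _]ffunE [wperm _ _ p]ffunE lift_perm_id insert_letter_at eqxx mul1r.
  rewrite conj_qXM.
  rewrite (_ : delete_letter p _ = wperm t w); last first.
    apply/ffunP => l; rewrite ffunE [LHS]ffunE [RHS]ffunE.
    by rewrite lift_perm_lift insert_letter_lift.
  by rewrite -!mulrA [LHS]mulrCA; congr (_ * _); rewrite mulrCA.
by rewrite !ffunE lift_perm_id (negbTE sk) !mul0r.
Qed.


(** Inserting a letter away from position [p] leaves the letter at [p] in place, as is the case for
    the first and for the last position. *)
Definition end_position (p : forall n, 'I_n.+1) : Prop :=
  forall n (k : 'I_n.+1), lift (lift (p n.+1) k) (p n) = p n.+1.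

Lemma end_position0 : end_position (fun n => ord0).
Proof. by move=> n k; apply: val_inj. Qed.

Lemma end_position_max : end_position (fun n => ord_max).
Proof.
by move=> n k; apply: val_inj; rewrite /= /bump; have := ltn_ord k; lia.
Qed.

Section Ends.
Variables (p : forall n, 'I_n.+1).
Hypothesis p_end : end_position p.

Lemma insert_letter_end n (k : 'I_n.+1) i (w : word n.+1) :
  insert_letter (lift (p n.+1) k) i w (p n.+1) = w (p n).
Proof. by have := insert_letter_lift (lift (p n.+1) k) i w (p n); rewrite p_end. Qed.

Lemma delete_insert_letter n (k : 'I_n.+1) i (w : word n.+1) :
  delete_letter (p n.+1) (insert_letter (lift (p n.+1) k) i w) =
  insert_letter k i (delete_letter (p n) w).
Proof.
apply/ffunP => l; rewrite ffunE; have [l'|] := unliftP k l => ->; last first.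
  by rewrite !insert_letter_at.
rewrite insert_letter_lift [RHS]ffunE.
rewrite (_ : lift (p n.+1) (lift k l') = lift (lift (p n.+1) k) (lift (p n) l')).
  by rewrite insert_letter_lift.
apply: val_inj; move: (congr1 val (p_end k)); rewrite /= /bump; lia.
Qed.

(* For [c] counting the distance to [p] this is the q-commutation relation; for
   the other end it gives the commutator of, say, L_i^* and R_j. *)
Lemma annihilate_create n (c : 'I_n.+2 -> nat) i j (x : tensor n.+1) :
  annihilate c i (create (p n.+1) j x) =
  ((i == j)%:R * qC ^+ c (p n.+1)) *: x +
  create (p n) j (annihilate (fun k => c (lift (p n.+1) k)) i x).
Proof.
(* Either the letter just created is removed, or one of the letters of [x]. *)
apply/ffunP => s; rewrite !ffunE (bigD1_ord (p n.+1)) //=.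
congr (_ + _).
  by rewrite ffunE insert_letter_at insert_letterK mulrCA mulrA.
rewrite mulr_sumr; apply: eq_bigr => k _; rewrite ffunE insert_letter_end.
by rewrite delete_insert_letter mulrCA.
Qed.
End Ends.

Lemma annihilate_create0 (p : 'I_1) (c : 'I_1 -> nat) i j (x : tensor 0) :
  annihilate c i (create p j x) = ((i == j)%:R * qC ^+ c p) *: x.
Proof.
apply/ffunP => s; rewrite !ffunE big_ord_recl big_ord0 addr0 (ord1 p) ffunE.
by rewrite insert_letter_at insert_letterK mulrCA mulrA.
Qed.

Lemma annihilateX n (c : 'I_n.+1 -> nat) m i (y : tensor n.+1) :
  annihilate (fun k => (c k + m)%N) i y = qC ^+ m *: annihilate c i y.
Proof.
apply/ffunP => s; rewrite !ffunE scaler_sumr; apply: eq_bigr => k _.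
by rewrite exprD -mulrA mulrCA.
Qed.

Lemma create_comm n i j (x : tensor n) :
  create ord0 i (create ord_max j x) = create ord_max j (create ord0 i x).
Proof.
apply/ffunP => s; rewrite !ffunE mulrCA; congr (_ * (_ * _)).
- by congr (s _ == _)%:R; apply: val_inj.
- by congr (s _ == _)%:R; apply: val_inj; rewrite /= /bump; lia.
congr (x _); apply/ffunP => l; rewrite !ffunE; congr (s _).
by apply: val_inj; rewrite /= /bump; have := ltn_ord l; lia.
Qed.

(** * Norm bounds, uniform in the degree, for either side *)

Section NormBound.
Variables (p : forall n, 'I_n.+1) (c : forall n, 'I_n.+1 -> nat).
Hypothesis hq : -1 < q < 1.
Hypothesis adj : forall n i (x : tensor n) y,
  qdot q (create (p n) i x) y = qdot q x (annihilate (@c n) i y).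
Hypothesis comm : forall n i j (x : tensor n.+1),
  annihilate (@c n.+1) i (create (p n.+1) j x) =
  (i == j)%:R *: x + qC *: create (p n) j (annihilate (@c n) i x).
Hypothesis comm0 : forall i j (x : tensor 0),
  annihilate (@c 0) i (create (p 0) j x) = (i == j)%:R *: x.

Let N n (x : tensor n) : R := Re (qdot q x x).
(** The solution of [K = 1 + |q| K], which is what the induction on the degree needs to close. *)
Let K : R := (1 - `|q|)^-1.

Lemma creation_bound_gt0 : 0 < K.
Proof. by rewrite invr_gt0 subr_gt0 ltr_norml. Qed.

Lemma creation_bound_ge0 : 0 <= K.
Proof. exact: ltW creation_bound_gt0. Qed.

Lemma creation_boundE : 1 + `|q| * K = K.
Proof.
have : 1 - `|q| != 0 by rewrite gt_eqF // subr_gt0 ltr_norml.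
by move=> h; rewrite /K; field.
Qed.

Lemma annihilate_adj n i (x : tensor n) y :
  qdot q y (create (p n) i x) = qdot q (annihilate (@c n) i y) x.
Proof. by rewrite qdotC adj -qdotC. Qed.

(* [|a^* x|^2 = |x|^2 + q |a x|^2], and [|a x|^2 <= K |x|^2] by induction, from
   expanding [0 <= |K x - a^* a x|^2]. *)
Lemma norm_create_le n i (x : tensor n) : N (create (p n) i x) <= K * N x.
Proof.
elim: n x => [|n IHn] x.
  rewrite /N adj comm0 eqxx scale1r ler_peMl ?(Re_qdot_ge0 hq) //.
  by rewrite -creation_boundE lerDl mulr_ge0 ?creation_bound_ge0.
have hA : N (annihilate (@c n) i x) <= K * N x.
  set y := annihilate _ i x.
  have h : 0 <= N (- K%:C *: x + create (p n) i y) by exact: Re_qdot_ge0.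
  move: h; rewrite /N (qdot_sq hq) annihilate_adj -/y.
  have := IHn y; rewrite /N.
  have := Im_qdot hq y; have := Re_qdot_ge0 hq y; have := creation_bound_ge0.
  case: (qdot q y y) => a a'; case: (qdot q x x) => b b' /= K0 a0 -> {a'}.
  move: (Re _) => e h1.
  (* With [y] the annihilated vector, the square expands to [K^2 |x|^2 - 2 K |y|^2] plus the squared
     norm of the creation of [y], which is at most [K |y|^2] by induction. *)
  move=> h2; rewrite -(ler_pM2l creation_bound_gt0); nra.
rewrite {1}/N adj comm eqxx scale1r.
have -> : qdot q x (x + qC *: create (p n) i (annihilate (@c n) i x)) =
    qdot q x x + q%:C * qdot q (annihilate (@c n) i x) (annihilate (@c n) i x).
  rewrite addrC qdot_linr annihilate_adj addrC; congr (_ + _ * _).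
  exact: conjc_real.
have ReM (z : C) : Re (q%:C * z) = q * Re z by case: z => a b /=; rewrite mul0r subr0.
rewrite -creation_boundE mulrDl mul1r raddfD /= lerD2l ReM -mulrA.
apply: le_trans (ler_norm _) _; rewrite normrM ler_wpM2l //.
by rewrite ger0_norm ?(Re_qdot_ge0 hq).
Qed.

(** The same square is expanded, now with [norm_create_le] in place of the induction hypothesis. *)
Lemma norm_annihilate_le n i (x : tensor n.+1) : N (annihilate (@c n) i x) <= K * N x.
Proof.
set y := annihilate _ i x.
have h : 0 <= N (- K%:C *: x + create (p n) i y) by exact: Re_qdot_ge0.
move: h; rewrite /N (qdot_sq hq) annihilate_adj -/y.
have := norm_create_le i y; rewrite /N.
have := Im_qdot hq y; have := Re_qdot_ge0 hq y.
case: (qdot q y y) => a a'; case: (qdot q x x) => b b' /= a0 -> {a'}.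
move: (Re _) => e h1 h2; have := creation_bound_gt0.
move=> K0; rewrite -(ler_pM2l K0); nra.
Qed.

End NormBound.

End Creation.

(** * Bounded operators on the Fock space that shift the degree by one *)

Section FockRaiseLower.
Variables (R : realType) (d : nat) (q : R) (hq : -1 < q < 1).
Notation C := R[i].
Local Notation tensor := (tensor R d).
Local Notation fock := (fock_space d hq).
Local Notation bop := (bounded_op (@fdot R d q hq)).
Local Notation N x := (Re (qdot q x x)).

Lemma nonneg_series_le (u : nat -> R) (M : R) : (forall n, 0 <= u n) ->
  (forall n, series u n <= M) -> cvgn (series u) /\ limn (series u) <= M.
Proof.
move=> u0 uM; have c : cvgn (series u).
  apply: nondecreasing_is_cvgn; first exact: nondecreasing_series.
  by exists M => _ [n _ <-].
by split=> //; apply: limr_le => //; apply: nearW.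
Qed.

Lemma csum_shift (u v : nat -> C) : u 0%N = 0 -> (forall n, u n.+1 = v n) ->
  csummable v -> csum u = csum v.
Proof.
move=> u0 uv [rv iv]; have shift (f : C -> R) : f 0 = 0 -> cvgn (series (fun n => f (v n))) ->
    limn (series (fun n => f (u n))) = limn (series (fun n => f (v n))).
  move=> f0 cv; apply: cvg_lim => //; rewrite -cvg_shiftS.
  rewrite (_ : (fun n => _) = series (fun n => f (v n))) //.
  apply/funext => n; rewrite /series /= big_nat_recl // u0 f0 add0r.
  by apply: eq_bigr => k _; rewrite uv.
by rewrite /csum !shift.
Qed.

Section Raise.
Variables (F : forall n, tensor n -> tensor n.+1) (G : forall n, tensor n.+1 -> tensor n).
Variable K : R.
Hypothesis K0 : 0 <= K.
Hypothesis F_linear : forall n, linear (@F n).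
Hypothesis G_linear : forall n, linear (@G n).
Hypothesis F_le : forall n (x : tensor n), N (F x) <= K * N x.
Hypothesis G_le : forall n (x : tensor n.+1), N (G x) <= K * N x.
Hypothesis FG_adj : forall n (x : tensor n) y, qdot q (F x) y = qdot q x (G y).

Definition raise_component (x : fock) n : tensor n :=
  if n is m.+1 then F (x m) else 0.

Definition lower_component (x : fock) n : tensor n := G (x n.+1).

Let NF (x : fock) : R := limn (series (fun n => N (x n))).

(** Bounding the partial sums by [K * NF x] yields both membership in the Fock space and the
    operator bound. *)
Lemma raise_bounds (x : fock) : summable_tensors q (raise_component x) /\
  limn (series (fun n => N (raise_component x n))) <= K * NF x.
Proof.
apply: nonneg_series_le => [n|[|n]]; first exact: Re_qdot_ge0.
  rewrite /series /= big_geq // mulr_ge0 //.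
  apply: limr_ge; first exact: component_summable.
  by apply: nearW => n; apply: sumr_ge0 => k _; exact: Re_qdot_ge0.
rewrite /series /= big_nat_recl //= (qdot0l q) add0r.
apply: (@le_trans _ _ (K * series (fun n => N (x n)) n)).
  by rewrite /series /= mulr_sumr; apply: ler_sum => k _.
apply: ler_wpM2l => //; apply: nondecreasing_cvgn_le; last exact: component_summable.
by apply: nondecreasing_series => k _ _; exact: Re_qdot_ge0.
Qed.

Lemma lower_bounds (x : fock) : summable_tensors q (lower_component x) /\
  limn (series (fun n => N (lower_component x n))) <= K * NF x.
Proof.
apply: nonneg_series_le => n; first exact: Re_qdot_ge0.
apply: (@le_trans _ _ (K * series (fun n => N (x n)) n.+1)).
  rewrite /series /= big_nat_recl // mulrDr mulr_sumr.
  apply: (@le_trans _ _ (\sum_(0 <= k < n) K * N (x k.+1))).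
    by apply: ler_sum => k _; exact: G_le.
  by rewrite lerDr mulr_ge0 // (Re_qdot_ge0 hq).
apply: ler_wpM2l => //; apply: nondecreasing_cvgn_le; last exact: component_summable.
by apply: nondecreasing_series => k _ _; exact: Re_qdot_ge0.
Qed.

Definition raise (x : fock) : fock := @Fock R d q hq _ (raise_bounds x).1.
Definition lower (x : fock) : fock := @Fock R d q hq _ (lower_bounds x).1.

Fact raise_linear : linear raise.
Proof.
move=> a x y; apply: fockP => -[|n] /=; last exact: F_linear.
by rewrite -[RHS]/(a *: 0 + 0) scaler0 addr0.
Qed.

Fact lower_linear : linear lower.
Proof. by move=> a x y; apply: fockP => n; exact: G_linear. Qed.

Fact raise_bounded : exists M : R,
  forall x, hnorm (@fdot R d q hq) (raise x) <= M * hnorm (@fdot R d q hq) x.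
Proof. by apply/bounded_sqr; exists K => // x; exact: (raise_bounds x).2. Qed.

Fact lower_bounded : exists M : R,
  forall x, hnorm (@fdot R d q hq) (lower x) <= M * hnorm (@fdot R d q hq) x.
Proof. by apply/bounded_sqr; exists K => // x; exact: (lower_bounds x).2. Qed.

Definition raise_op : bop := BoundedOp raise_linear raise_bounded.
Definition lower_op : bop := BoundedOp lower_linear lower_bounded.

(** The raised vector has no component of degree [0], so the two series differ by a shift of
    index. *)
Lemma raise_lower_adj x y : fdot (raise_op x) y = fdot x (lower_op y).
Proof.
apply: csum_shift => [|n|]; first exact: (qdot0l q).
  exact: FG_adj.
by apply: csummable_qdot => //; exact: component_summable.
Qed.

End Raise.

End FockRaiseLower.

(** * Left and right operators: relations and adjoints *)

Section FockOps.
Variables (R : realType) (d : nat) (q : R) (hq : -1 < q < 1).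
Notation C := R[i].
Local Notation tensor := (tensor R d).
Local Notation fock := (fock_space d hq).
Local Notation bop := (bounded_op (@fdot R d q hq)).
Local Notation qC := (q%:C : C).
Implicit Types (i j : 'I_d).

(** The distances of position [k] from the left and right ends, which are the inversion counts of
    [inversions_lift_perm0] and [inversions_lift_perm_max]. *)
Definition lcost n (k : 'I_n.+1) : nat := k.
Definition rcost n (k : 'I_n.+1) : nat := (n - k)%N.

(** A letter created at one end moves the others one step away from that end, hence the factor [q]
    in the commutation relations of one side; distances from the opposite end are unchanged. *)
Lemma lcost_lift0 n :
  (fun k : 'I_n.+1 => lcost (lift (ord0 : 'I_n.+2) k)) = (fun k => (lcost k + 1)%N).
Proof. by apply/funext => k; rewrite /lcost /= /bump; lia. Qed.

Lemma rcost_lift0 n : (fun k : 'I_n.+1 => rcost (lift (ord0 : 'I_n.+2) k)) = @rcost n.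
Proof. by apply/funext => k; rewrite /rcost /= /bump; lia. Qed.

Lemma lcost_lift_max n : (fun k : 'I_n.+1 => lcost (lift (ord_max : 'I_n.+2) k)) = @lcost n.
Proof. by apply/funext => k; rewrite /lcost lift_max. Qed.

Lemma rcost_lift_max n :
  (fun k : 'I_n.+1 => rcost (lift (ord_max : 'I_n.+2) k)) = (fun k => (rcost k + 1)%N).
Proof. by apply/funext => k; rewrite /rcost lift_max; have := ltn_ord k; lia. Qed.

Lemma createZ n (p : 'I_n.+1) i a (x : tensor n) : create p i (a *: x) = a *: create p i x.
Proof. by apply/ffunP => s; rewrite !ffunE mulrCA. Qed.

Lemma qdot_createl n i (x : tensor n) y :
  qdot q (create ord0 i x) y = qdot q x (annihilate q (@lcost n) i y).
Proof. by apply: qdot_create => k t; exact: inversions_lift_perm0. Qed.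

Lemma qdot_creater n i (x : tensor n) y :
  qdot q (create ord_max i x) y = qdot q x (annihilate q (@rcost n) i y).
Proof. by apply: qdot_create => k t; exact: inversions_lift_perm_max. Qed.

Lemma annihilatel_createl n i j (x : tensor n.+1) :
  annihilate q (@lcost n.+1) i (create ord0 j x) =
  (i == j)%:R *: x + qC *: create ord0 j (annihilate q (@lcost n) i x).
Proof.
rewrite (annihilate_create q end_position0) lcost_lift0 annihilateX expr1.
by rewrite createZ /lcost expr0 mulr1.
Qed.

Lemma annihilater_creater n i j (x : tensor n.+1) :
  annihilate q (@rcost n.+1) i (create ord_max j x) =
  (i == j)%:R *: x + qC *: create ord_max j (annihilate q (@rcost n) i x).
Proof.
rewrite (annihilate_create q end_position_max) rcost_lift_max annihilateX expr1.
by rewrite createZ /rcost subnn expr0 mulr1.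
Qed.

Lemma annihilatel_createl0 i j (x : tensor 0) :
  annihilate q (@lcost 0) i (create ord0 j x) = (i == j)%:R *: x.
Proof. by rewrite annihilate_create0 /lcost expr0 mulr1. Qed.

Lemma annihilater_creater0 i j (x : tensor 0) :
  annihilate q (@rcost 0) i (create ord_max j x) = (i == j)%:R *: x.
Proof. by rewrite annihilate_create0 /rcost subnn expr0 mulr1. Qed.

Definition creationL i : bop := raise_op hq (creation_bound_ge0 hq)
  (fun n => create_linear ord0 i)
  (fun n => norm_create_le hq qdot_createl annihilatel_createl annihilatel_createl0 i).

Definition annihilationL i : bop := lower_op hq (creation_bound_ge0 hq)
  (fun n => annihilate_linear q (@lcost n) i)
  (fun n => norm_annihilate_le hq qdot_createl annihilatel_createl annihilatel_createl0 i).

Definition creationR i : bop := raise_op hq (creation_bound_ge0 hq)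
  (fun n => create_linear ord_max i)
  (fun n => norm_create_le hq qdot_creater annihilater_creater annihilater_creater0 i).

Definition annihilationR i : bop := lower_op hq (creation_bound_ge0 hq)
  (fun n => annihilate_linear q (@rcost n) i)
  (fun n => norm_annihilate_le hq qdot_creater annihilater_creater annihilater_creater0 i).

Lemma creationL_adj i x y : fdot (creationL i x) y = fdot x (annihilationL i y).
Proof. by apply: raise_lower_adj => n; exact: qdot_createl. Qed.

Lemma creationR_adj i x y : fdot (creationR i x) y = fdot x (annihilationR i y).
Proof. by apply: raise_lower_adj => n; exact: qdot_creater. Qed.

Lemma annihilationL_creationL i j x : annihilationL i (creationL j x) =
  (i == j)%:R *: x + qC *: creationL j (annihilationL i x).
Proof.
apply: fockP => -[|n]; last exact: annihilatel_createl.
by rewrite [LHS]annihilatel_createl0 -[RHS]/(_ *: x 0%N + qC *: 0) scaler0 addr0.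
Qed.

Lemma creationLR i j x : creationL i (creationR j x) = creationR j (creationL i x).
Proof.
apply: fockP => -[|[|n]] //; last exact: create_comm.
have c0 (p : 'I_1) k : create p k (0 : tensor 0) = 0.
  by rewrite -(scale0r 0) createZ !scale0r.
by rewrite -[LHS]/(create ord0 i 0) -[RHS]/(create ord_max j 0) !c0.
Qed.

(** In degree [n], both sides are [(i == j)%:R * qC ^+ n] times the component of [x]: the created
    letter lies at distance [n] from the end where annihilation starts. *)
Lemma cross_commutators i j x :
  annihilationL i (creationR j x) - creationR j (annihilationL i x) =
  annihilationR j (creationL i x) - creationL i (annihilationR j x).
Proof.
apply: fockP => -[|n].
  rewrite -[LHS]/(annihilate q (@lcost 0) i (create ord_max j (x 0%N)) - 0).
  rewrite -[RHS]/(annihilate q (@rcost 0) j (create ord0 i (x 0%N)) - 0).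
  by rewrite !annihilate_create0 /rcost /lcost /= eq_sym.
rewrite -[LHS]/(annihilate q (@lcost n.+1) i (create ord_max j (x n.+1))
   - create ord_max j (annihilate q (@lcost n) i (x n.+1))).
rewrite -[RHS]/(annihilate q (@rcost n.+1) j (create ord0 i (x n.+1))
   - create ord0 i (annihilate q (@rcost n) j (x n.+1))).
rewrite (annihilate_create q end_position0) rcost_lift0.
rewrite (annihilate_create q end_position_max) lcost_lift_max.
by rewrite !addrK /rcost /lcost subn0 eq_sym.
Qed.

Lemma fdot_eq0 (x : fock) : fdot x x = 0 -> x = 0.
Proof. by move=> e; apply/eqP; apply: contraT => /fdot_gt0; rewrite e ltxx. Qed.

Lemma fdotBr (x y z : fock) : fdot z (x - y) = fdot z x - fdot z y.
Proof. exact: linearBr. Qed.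

Lemma fdot_inj (x y : fock) : (forall z, fdot z x = fdot z y) -> x = y.
Proof.
by move=> h; apply/eqP; rewrite -subr_eq0; apply/eqP/fdot_eq0; rewrite fdotBr h subrr.
Qed.

(** The adjoint form of [creationLR]. *)
Lemma annihilationLR i j x :
  annihilationL i (annihilationR j x) = annihilationR j (annihilationL i x).
Proof.
apply: fdot_inj => z.
by rewrite -creationL_adj -!creationR_adj -creationLR creationL_adj.
Qed.

(** The witness [B] is unique by nondegeneracy, so [xget] must return it. *)
Lemma adjointE (A B : bop) : (forall x y, fdot (A x) y = fdot x (B y)) -> adjoint A = B.
Proof.
move=> h; apply: xget_unique => // B' h'; apply: bopP => y; apply: fdot_inj => z.
exact: etrans (esym (h' z y)) (h z y).
Qed.

Lemma bop_raddf (A : bop) : {morph A : x y / x + y}.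
Proof. by move=> x y; have := bop_linear A 1 x y; rewrite !scale1r. Qed.

Lemma bopZ (A : bop) a x : A (a *: x) = a *: A x.
Proof.
have A0 : A 0 = 0.
  by have /eqP := bop_raddf A 0 0; rewrite addr0 -subr_eq0 opprD addNKr oppr_eq0 => /eqP.
by have := bop_linear A a x 0; rewrite A0 !addr0.
Qed.

Lemma bop_sum (A : bop) (I : Type) (r : seq I) (P : pred I) (F : I -> fock) :
  A (\sum_(k <- r | P k) F k) = \sum_(k <- r | P k) A (F k).
Proof.
apply: (big_morph A (bop_raddf A)).
by have := bopZ A 0 0; rewrite !scale0r.
Qed.

Lemma sum_bopE (I : Type) (r : seq I) (P : pred I) (F : I -> bop) x :
  (\sum_(k <- r | P k) F k) x = \sum_(k <- r | P k) F k x.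
Proof. by apply: (big_morph (fun A : bop => A x)). Qed.


(** * Bounded operators are determined by elementary tensors *)

Section Density.
Implicit Types x : fock.

Definition truncation_component (m : nat) x n : tensor n := if (n < m)%N then x n else 0.

Let NE x n : R := Re (qdot q (x n) (x n)).

Lemma truncation_summable m x : summable_tensors q (truncation_component m x).
Proof.
apply: (@series_le_cvg _ _ (NE x)) => [n|n|n|]; last exact: component_summable.
- exact: Re_qdot_ge0.
- exact: Re_qdot_ge0.
rewrite /truncation_component; case: ifP => // _.
by rewrite qdot0l (Re_qdot_ge0 hq).
Qed.

Definition truncation m x : fock := @Fock R d q hq _ (@truncation_summable m x).

(** From index [m] on, the partial sums for the tail are those for [x] without the first [m]
    terms. *)
Lemma norm_truncation m x :
  Re (fdot (x - truncation m x) (x - truncation m x)) =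
  limn (series (NE x)) - series (NE x) m.
Proof.
have e n : x n - truncation m x n = if (n < m)%N then 0 else x n.
  by rewrite /= /truncation_component; case: ifP; rewrite ?subrr ?subr0.
rewrite /fdot /=; apply: cvg_lim => //.
have : (series (NE x) n - series (NE x) m @[n --> \oo] -->
         limn (series (NE x)) - series (NE x) m)%classic.
  by apply: cvgB; [exact: component_summable | exact: cvg_cst].
apply: cvg_trans; apply: near_eq_cvg; exists m => // n /= mn.
rewrite /series /= (big_cat_nat (n := m)) //= addrAC subrr add0r.
rewrite [RHS](big_cat_nat (n := m)) //= [X in _ = X + _]big_nat [X in _ = X + _]big1.
  rewrite add0r !big_nat; apply: eq_bigr => k /andP[mk _].
  by have := e k; rewrite /NE /= ltnNge mk /= => ->.
by move=> k /andP[_ km]; have := e k; rewrite /= km => ->; rewrite qdot0l.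
Qed.

Definition word_vector n (w : word d n) : fock :=
  etens hq [seq basis_vec R (w l) | l <- enum 'I_n].

Lemma etens_wordE n (w : word d n) :
  etens_component [seq basis_vec R (w l) | l <- enum 'I_n] n = [ffun s => (s == w)%:R].
Proof.
rewrite /etens_component size_map size_enum_ord eqxx; apply/ffunP => s; rewrite !ffunE.
have -> : (s == w) = [forall l, s l == w l].
  by apply/eqP/forallP => [-> //|h]; apply/ffunP => l; apply/eqP.
under eq_bigr => l _.
  rewrite (nth_map l) ?size_enum_ord // nth_ord_enum mxE eqxx /=.
  over.
have [/forallP h|/forallPn[l hl]] := boolP [forall l, s l == w l].
  by rewrite big1 // => l _; rewrite (eqP (h l)) eqxx.
by rewrite (bigD1 l) //= (negbTE hl) mul0r.
Qed.

Lemma truncationS m x :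
  truncation m.+1 x = truncation m x + \sum_(w : word d m) x m w *: word_vector w.
Proof.
have comp (F : word d m -> fock) n : (\sum_w F w : fock) n = \sum_w F w n.
  exact: (big_morph (fun y : fock => y n)).
apply: fockP => n; rewrite -[RHS]/(truncation m x n + (\sum_w _ : fock) n) comp.
have scaleE (a : C) (y : fock) : (a *: y : fock) n = a *: y n by [].
under eq_bigr => w _ do rewrite scaleE.
rewrite /= /truncation_component ltnS leq_eqVlt.
have [->|nm] := eqVneq n m.
  rewrite ltnn add0r; apply/ffunP => s; rewrite sum_ffunE (bigD1 s) //= big1.
    by rewrite addr0 etens_wordE !ffunE eqxx [RHS]mulr1.
  by move=> w ws; rewrite etens_wordE !ffunE eq_sym (negbTE ws) [LHS]mulr0.
rewrite big1 ?addr0 // => w _.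
rewrite /etens_component size_map size_enum_ord.
by rewrite eq_sym (negbTE nm) scaler0.
Qed.

(** The operators agree on truncations, which are finite combinations of elementary tensors, and the
    truncations of [x] converge to [x]. *)
Lemma bop_eq_etens (A B : bop) : (forall s, A (etens hq s) = B (etens hq s)) -> A = B.
Proof.
move=> AB; apply: bopP => x; apply/eqP; rewrite -subr_eq0; apply/eqP/fdot_eq0.
have trunc0 m : A (truncation m x) = B (truncation m x).
  elim: m => [|m IHm].
    have -> : truncation 0 x = 0 by apply: fockP.
    by rewrite -(scale0r 0) !bopZ !scale0r.
  rewrite truncationS !bop_raddf !bop_sum IHm; congr (_ + _).
  by apply: eq_bigr => w _; rewrite !bopZ AB.
have /bounded_sqr[K K0 hK] := bop_bounded (A - B).
set z := A x - B x.
(* Since [A - B] kills truncations, [z] is the image of every tail, and the norms of the tails tend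
   to zero. *)
have zE m : z = (A - B) (x - truncation m x).
  rewrite (_ : x - _ = -1 *: truncation m x + x); last by rewrite scaleN1r addrC.
  rewrite bop_linear scaleN1r.
  by rewrite -[(A - B) (truncation m x)]/(A _ - B _) trunc0 subrr oppr0 add0r.
have zle m : Re (fdot z z) <= K * (limn (series (NE x)) - series (NE x) m).
  by rewrite {1 2}(zE m) -norm_truncation; exact: hK.
have z0 : Re (fdot z z) <= 0.
  have cv : (K * (limn (series (NE x)) - series (NE x) n) @[n --> \oo] --> (K * 0 : R))%classic.
    apply: cvgMr; rewrite -(subrr (limn (series (NE x)))).
    by apply: cvgB; [exact: cvg_cst | exact: component_summable].
  rewrite -(mulr0 K) -(cvg_lim _ cv) //; apply: limr_ge; first exact: cvgP cv.
  by apply: nearW.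
apply/eqP; apply: contraTT z0 => zn0.
have /fdot_gt0 : z != 0.
  by apply: contra zn0 => /eqP ->; rewrite linear0l.
by rewrite ltcE -ltNge => /andP[_].
Qed.

Lemma creationL_etens i s : creationL i (etens hq s) = etens hq (basis_vec R i :: s).
Proof.
apply: fockP => -[|n] //=; rewrite /etens_component /= eqSS.
case: ifP => _; last by rewrite -(scale0r 0) createZ !scale0r.
apply/ffunP => w; rewrite !ffunE big_ord_recl /= mxE eqxx /=; congr (_ * _).
by apply: eq_bigr => l _; rewrite ffunE.
Qed.

Lemma creationR_etens i s : creationR i (etens hq s) = etens hq (rcons s (basis_vec R i)).
Proof.
apply: fockP => -[|n] /=; rewrite /etens_component size_rcons // eqSS.
case: eqP => [sn|_]; last by rewrite -(scale0r 0) createZ !scale0r.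
apply/ffunP => w; rewrite !ffunE big_ord_recr /= mulrC nth_rcons sn ltnn eqxx.
rewrite mxE eqxx /=; congr (_ * _).
apply: eq_bigr => l _; rewrite ffunE nth_rcons sn ltn_ord.
rewrite (_ : lift ord_max l = widen_ord (leqnSn n) l) //.
by apply: val_inj; rewrite /= /bump leqNgt ltn_ord.
Qed.

Lemma left_creationE i : left_creation hq (basis_vec R i) = creationL i.
Proof.
apply: xget_unique => [s|A hA]; first exact: creationL_etens.
by apply: bop_eq_etens => s; rewrite hA creationL_etens.
Qed.

Lemma right_creationE i : right_creation hq (basis_vec R i) = creationR i.
Proof.
apply: xget_unique => [s|A hA]; first exact: creationR_etens.
by apply: bop_eq_etens => s; rewrite hA creationR_etens.
Qed.

End Density.

Definition fieldL i : bop := creationL i + annihilationL i.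
Definition fieldR i : bop := creationR i + annihilationR i.

Lemma T_opE : T_op d hq = \sum_(i < d) fieldL i * fieldR i.
Proof.
rewrite /T_op; apply: eq_bigr => i _; rewrite left_creationE right_creationE.
by rewrite (adjointE (@creationL_adj i)) (adjointE (@creationR_adj i)).
Qed.

Lemma fieldLR i j x : fieldL i (fieldR j x) = fieldR j (fieldL i x).
Proof.
rewrite -[LHS]/(creationL i (creationR j x + annihilationR j x)
  + annihilationL i (creationR j x + annihilationR j x)).
rewrite -[RHS]/(creationR j (creationL i x + annihilationL i x)
  + annihilationR j (creationL i x + annihilationL i x)).
rewrite !bop_raddf creationLR annihilationLR.
have /eqP := cross_commutators i j x; rewrite subr_eq => /eqP ->.
by rewrite -!addrA; congr (_ + _); rewrite addrCA addNKr addrCA.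
Qed.

Lemma fieldL_adj i x y : fdot (fieldL i x) y = fdot x (fieldL i y).
Proof.
have adj' : fdot (annihilationL i x) y = fdot x (creationL i y).
  by rewrite fdotC [RHS]fdotC creationL_adj.
rewrite -[fieldL i x]/(creationL i x + annihilationL i x).
rewrite -[fieldL i y]/(creationL i y + annihilationL i y).
by rewrite linearDl linearDr /= creationL_adj adj' addrC.
Qed.

Lemma fieldR_adj i x y : fdot (fieldR i x) y = fdot x (fieldR i y).
Proof.
have adj' : fdot (annihilationR i x) y = fdot x (creationR i y).
  by rewrite fdotC [RHS]fdotC creationR_adj.
rewrite -[fieldR i x]/(creationR i x + annihilationR i x).
rewrite -[fieldR i y]/(creationR i y + annihilationR i y).
by rewrite linearDl linearDr /= creationR_adj adj' addrC.
Qed.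

(** Both factors are symmetric, so the adjoint of a summand is the product in reverse order, which
    [fieldLR] restores. *)
Lemma T_op_adj : adjoint (T_op d hq) = T_op d hq.
Proof.
apply: adjointE => x y; rewrite T_opE !sum_bopE linear_sumlz linear_sumr.
apply: eq_bigr => i _.
rewrite -[LHS]/(fdot (fieldL i (fieldR i x)) y) -[RHS]/(fdot x (fieldL i (fieldR i y))).
by rewrite fieldL_adj fieldR_adj -fieldLR.
Qed.

End FockOps.

(** * The q-Wick formula and the moments *)

Section Wick.
Variables (R : realType) (d : nat) (q : R) (hq : -1 < q < 1).
Notation C := R[i].
Local Notation fock := (fock_space d hq).
Local Notation qC := (q%:C : C).
Implicit Types (i j : 'I_d) (u : seq 'I_d).

Definition basis_tensor u : fock := etens hq [seq basis_vec R i | i <- u].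

Definition field_vector u : fock := foldr (fun i => fieldL hq i) (basis_tensor [::]) u.

Lemma basis_tensor_cons i u : basis_tensor (i :: u) = creationL hq i (basis_tensor u).
Proof. by rewrite creationL_etens. Qed.

Lemma annihilationL_vacuum i : annihilationL hq i (basis_tensor [::]) = 0.
Proof.
apply: fockP => n; rewrite -[LHS]/(annihilate q (@lcost n) i 0).
by apply/ffunP => s; rewrite !ffunE big1 // => k _; rewrite ffunE mulr0.
Qed.

(** This iterates the q-commutation relation. Words are given by increasing lists of positions, so
    that [s] can be the list of open points of a matching. *)
Lemma annihilationL_basis m (c : 'I_m -> 'I_d) i (s : seq 'I_m) :
  sorted (fun a b : 'I_m => (a < b)%N) s ->
  annihilationL hq i (basis_tensor (map c s)) =
  \sum_(k <- s) ((c k == i)%:R * qC ^+ count (fun b : 'I_m => (b < k)%N) s) *: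
     basis_tensor (map c (rem k s)).
Proof.
elim: s => [|a s IHs] hs; first by rewrite big_nil annihilationL_vacuum.
have a_lt : {in s, forall k : 'I_m, (a < k)%N}.
  by apply/allP; apply: order_path_min hs => x y z; apply: ltn_trans.
rewrite [map c _]map_cons basis_tensor_cons annihilationL_creationL IHs ?(path_sorted hs) //.
rewrite big_cons; congr (_ + _).
  rewrite /= eqxx ltnn eq_sym add0n (_ : count _ s = 0%N) ?expr0 ?mulr1 //.
  apply/eqP; rewrite -leqn0 leqNgt -has_count.
  by apply/hasPn => k /a_lt; rewrite -leqNgt => /ltnW.
rewrite bop_sum scaler_sumr !big_seq; apply: eq_bigr => k ks.
rewrite bopZ -basis_tensor_cons scalerA /=.
have ak := a_lt _ ks; rewrite ak.
rewrite (_ : a == k = false); last by apply/eqP => e; rewrite e ltnn in ak.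
by rewrite exprS mulrCA.
Qed.

Lemma open_points_sorted m (f : 'S_m) :
  sorted (fun a b : 'I_m => (a < b)%N) (open_points f).
Proof.
apply: sorted_filter => [x y z|]; first exact: ltn_trans.
by have := iota_ltn_sorted 0 m; rewrite -val_enum_ord sorted_map.
Qed.

(** A Wick formula for vectors, proved by adding letters on the left. Creation leaves the new point
    open; annihilation joins it to an open point [k] of the same colour, and its power of [q] counts
    the open points left of [k], as in [crossing_number_add_arc]. *)
Lemma wick m (c : 'I_m -> 'I_d) :
  field_vector (map c (enum 'I_m)) =
  \sum_(f : 'S_m | matching f && [forall x, c (f x) == c x])
     qC ^+ crossing_number f *: basis_tensor (map c (open_points f)).
Proof.
elim: m c => [|m IHm] c.
  rewrite enum_ord0 (big_pred1 1%g) => [|f].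
    by rewrite /crossing_number /open_points big_ord0 enum_ord0 scale1r.
  rewrite -[RHS]/(f == 1%g); transitivity true.
    by apply/andP; split; [apply/matchingP|apply/forallP] => -[].
  by apply/esym/eqP/permP => -[].
pose c' x := c (lift ord0 x).
rewrite enum_ordSl map_cons -map_comp.
rewrite -[LHS]/(fieldL hq (c ord0) (field_vector (map c' (enum 'I_m)))).
rewrite IHm bop_sum big_mkcond [RHS]big_mkcond (sum_permS _ (@add_arc_injective m)).
apply: eq_bigr => g _; rewrite big_ord_recl.
rewrite matching_add_arc0.
have cE : [forall x, c (add_arc g ord0 x) == c x] = [forall x, c' (g x) == c' x].
  apply/forallP/forallP => h x.
    by have := h (lift ord0 x); rewrite add_arc0 lift_perm_lift.
  have [y|] := unliftP ord0 x => ->; rewrite add_arc0 ?lift_perm_lift ?lift_perm_id //.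
  exact: h.
(* If [g] is not a colour-preserving matching, then neither is any of its extensions, and both sides
   vanish. *)
rewrite cE; case: ifP => [/andP[gm gc]|no]; last first.
  rewrite add0r big1 // => k _; rewrite matching_add_arc.
  case: ifP => // /andP[/andP[/eqP gk gm] /forallP ck].
  move: no; rewrite gm /= => /negbT/forallPn[x]; case/negP.
  have [->|xk] := eqVneq x k; first by rewrite gk.
  by have := ck (lift ord0 x); rewrite add_arc_lift // (negbTE xk).
rewrite bopZ -[fieldL hq _ _]/(creationL hq (c ord0) _ + annihilationL hq (c ord0) _) scalerDr.
congr (_ + _).
  rewrite -basis_tensor_cons crossing_number_add_arc0 open_points_add_arc0.
  by rewrite map_cons -map_comp.
rewrite annihilationL_basis ?open_points_sorted // scaler_sumr big_filter big_enum_cond.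
rewrite [LHS]big_mkcond; apply: eq_bigr => k _; rewrite matching_add_arc gm andbT.
case: eqP => [gk|//] /=.
have -> : [forall x, c (add_arc g (lift ord0 k) x) == c x] = (c' k == c ord0).
  apply/forallP/idP => [/(_ ord0)|/eqP ck x]; first by rewrite add_arc_ord0.
  have [y|] := unliftP ord0 x => ->; last by rewrite add_arc_ord0 -ck.
  rewrite add_arc_lift //; case: (y =P k) => [->|_]; first by rewrite -ck.
  exact: (forallP gc).
case: eqP => _; last by rewrite mul0r scale0r scaler0.
rewrite mul1r scalerA -exprD crossing_number_add_arc //.
by rewrite open_points_add_arc // -map_comp.
Qed.

Lemma fdot_vacuum : fdot (basis_tensor [::]) (basis_tensor [::]) = 1 :> C.
Proof.
have dot0 n : qdot q (basis_tensor [::] n) (basis_tensor [::] n) = (n == 0%N)%:R.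
  case: n => [|n]; last exact: qdot0l.
  rewrite qdot_tens (big_pred1 1%g) => [|f].
    rewrite big_ord0 mulr1 (_ : inversions _ = 0%N) ?expr0 //.
    by apply: eq_card0 => -[[]].
  by rewrite -[RHS]/(f == 1%g); apply/esym/eqP/permP => -[].
rewrite /fdot (_ : (fun n => _) = fun n => (n == 0%N)%:R :> C); last exact/funext.
have limRe : limn (series (fun n => Re ((n == 0%N)%:R : C))) = (1 : R).
  apply: cvg_lim => //; apply: cvg_near_cst; exists 1%N => // -[|n] //= _.
  by rewrite /series /= big_nat_recl //= big1 ?addr0.
have limIm : limn (series (fun n => Im ((n == 0%N)%:R : C))) = (0 : R).
  apply: cvg_lim => //; apply: cvg_near_cst; exists 0%N => // n _.
  by rewrite /series /= big1 // => -[|k].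
by rewrite /csum limRe limIm.
Qed.

Lemma fdot_basis_vacuum u : fdot (basis_tensor u) (basis_tensor [::]) = (nilp u)%:R.
Proof.
case: u => [|i u]; first exact: fdot_vacuum.
by rewrite basis_tensor_cons creationL_adj annihilationL_vacuum linear0r.
Qed.

(** Only matchings without open points contribute to the vacuum component of [wick]. *)
Lemma fdot_field_vector m (c : 'I_m -> 'I_d) :
  fdot (field_vector (map c (enum 'I_m))) (basis_tensor [::]) =
  \sum_(f : 'S_m | complete_matching f && [forall x, c (f x) == c x])
    qC ^+ crossing_number f.
Proof.
rewrite wick linear_sumlz big_mkcond [RHS]big_mkcond; apply: eq_bigr => f _.
rewrite /complete_matching -andbA [[forall x, f x != x] && _]andbC andbA.
case: (matching f && _) => //=; rewrite linearZl_LR /= fdot_basis_vacuum.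
have -> : nilp (map c (open_points f)) = [forall x, f x != x].
  rewrite /nilp size_map size_filter -leqn0 leqNgt -has_count.
  apply/hasPn/forallP => h x; last by move=> _; exact: h.
  by apply: h; rewrite mem_enum.
by case: ifP; rewrite ?mulr1 ?mulr0.
Qed.

(** * Palindromic words and moments *)

Lemma fieldR_vacuum i : fieldR hq i (basis_tensor [::]) = fieldL hq i (basis_tensor [::]).
Proof.
rewrite -[LHS]/(creationR hq i _ + annihilationR hq i _).
rewrite -[RHS]/(creationL hq i _ + annihilationL hq i _).
rewrite creationR_etens creationL_etens; congr (_ + _); apply: fockP => n.
rewrite -[LHS]/(annihilate q (@rcost n) i 0) -[RHS]/(annihilate q (@lcost n) i 0).
by apply/ffunP => s; rewrite !ffunE !big1 // => k _; rewrite ffunE mulr0.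
Qed.

Lemma fieldR_field_vector i u :
  fieldR hq i (field_vector u) = field_vector (rcons u i).
Proof.
elim: u => [|j u IHu]; first exact: fieldR_vacuum.
by rewrite -[LHS]/(fieldR hq i (fieldL hq j (field_vector u))) -fieldLR IHu.
Qed.

Lemma T_op_pow_vacuum n : (T_op d hq ^+ n) (vacuum d hq) =
  \sum_(w : n.-tuple 'I_d) field_vector (w ++ rev w).
Proof.
elim: n => [|n IHn].
  by rewrite (big_pred1 [tuple]) // => t; rewrite [t]tuple0 //= eqxx.
rewrite exprS -[LHS]/(T_op d hq ((T_op d hq ^+ n) _)) IHn T_opE sum_bopE.
transitivity (\sum_(i < d) \sum_(w : n.-tuple 'I_d)
    field_vector (i :: rcons (w ++ rev w) i)).
  apply: eq_bigr => i _; rewrite bop_sum; apply: eq_bigr => w _.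
  by rewrite -[LHS]/(fieldL hq i (fieldR hq i _)) fieldR_field_vector.
(* Surrounding the palindrome of [w] by [i] gives the palindrome of [i :: w]. *)
rewrite pair_bigA [RHS](reindex (fun p : 'I_d * n.-tuple 'I_d => [tuple of p.1 :: p.2])).
  by apply: eq_bigr => -[i w] _; rewrite /= rev_cons rcons_cat.
exists (fun t : n.+1.-tuple 'I_d => (thead t, [tuple of behead t])) => [[i w] _|t _] /=.
  by congr (_, _); apply: val_inj.
by case/tupleP: t => i w; apply: val_inj.
Qed.

(** The map from [w] to [w ++ rev w] is a bijection onto the colourings constant on the rainbow
    arcs, so [card_arcs_colorings] applies. *)
Lemma card_palindromic_colorings n (d_gt0 : (0 < d)%N) (f : 'S_(2 * n)) :
  complete_matching f ->
  #|[set w : n.-tuple 'I_d | [forall x, nth (Ordinal d_gt0) (w ++ rev w) (f x) ==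
       nth (Ordinal d_gt0) (w ++ rev w) x]]| =
  (d ^ #|partition_join (arcs f) (rainbow n)|)%N.
Proof.
move=> fc; set i0 := Ordinal d_gt0.
pose fold (w : n.-tuple 'I_d) : {ffun 'I_(2 * n) -> 'I_d} :=
  [ffun x : 'I_(2 * n) => nth i0 (w ++ rev w) x].
have sz (w : n.-tuple 'I_d) : size (w ++ rev w) = (2 * n)%N.
  by rewrite size_cat size_rev size_tuple mul2n addnn.
have fold_rev w (x : 'I_(2 * n)) : fold w (rev_ord x) = fold w x.
  have e : w ++ rev w = rev (w ++ rev w) by rewrite rev_cat revK.
  by rewrite !ffunE [in RHS]e nth_rev sz.
have fold_lt (w : n.-tuple 'I_d) (x : 'I_(2 * n)) : (x < n)%N -> fold w x = nth i0 w x.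
  by move=> xn; rewrite ffunE nth_cat size_tuple xn.
have wid (x : 'I_n) : (x < 2 * n)%N by have := ltn_ord x; lia.
have fold_inj : injective fold.
  move=> w w' e; apply: eq_from_tnth => x; rewrite !(tnth_nth i0).
  by have := ltn_ord x; move/ffunP: e => /(_ (Ordinal (wid x))) e xn; rewrite !fold_lt in e.
rewrite rainbow_arcs -card_arcs_colorings ?complete_matching_rev // -(card_imset _ fold_inj).
apply: eq_card => c; rewrite !inE; apply/imsetP/andP => [[w]|[cf /forallP cr]].
  rewrite inE => /forallP wf ->; split; apply/forallP => x.
    by have := wf x; rewrite !ffunE.
  by rewrite permE fold_rev.
(* A colouring that is invariant under reversal is recovered from its first half. *)
have ce : c = fold [tuple c (Ordinal (wid x)) | x < n].
  have lt_n (x : 'I_(2 * n)) : (x < n)%N -> c x = fold [tuple c (Ordinal (wid x)) | x < n] x.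
    move=> xn; rewrite fold_lt // (_ : nth _ _ x = c (Ordinal (wid (Ordinal xn)))).
      by congr (c _); apply: val_inj.
    by rewrite -(tnth_mktuple (fun x => c (Ordinal (wid x)))) (tnth_nth i0).
  apply/ffunP => x; have [/lt_n //|nx] := ltnP x n.
  rewrite -fold_rev -lt_n; last by rewrite /=; have := ltn_ord x; lia.
  by have := cr x; rewrite permE => /eqP.
exists [tuple c (Ordinal (wid x)) | x < n] => //; rewrite inE; apply/forallP => x.
by have := forallP cf x; rewrite {1 2}ce !ffunE.
Qed.

Lemma vacuum_state_T_op_pow n : (0 < d)%N -> (0 < n)%N ->
  vacuum_state (T_op d hq ^+ n) = (Qtilde n d%:R q)%:C.
Proof.
move=> d_gt0 n_gt0; rewrite /vacuum_state T_op_pow_vacuum linear_sumlz.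
rewrite -[vacuum d hq]/(basis_tensor [::]).
have seqE (w : n.-tuple 'I_d) : w ++ rev w =
    map (fun x : 'I_(2 * n) => nth (Ordinal d_gt0) (w ++ rev w) x) (enum 'I_(2 * n)).
  have sz : size (w ++ rev w) = (2 * n)%N.
    by rewrite size_cat size_rev size_tuple mul2n addnn.
  apply: (@eq_from_nth _ (Ordinal d_gt0)); first by rewrite size_map size_enum_ord.
  move=> k; rewrite sz => kn; rewrite (nth_map (Ordinal kn)) ?size_enum_ord //.
  by rewrite nth_enum_ord.
have stateE (w : n.-tuple 'I_d) : fdot (field_vector (w ++ rev w)) (basis_tensor [::]) =
    \sum_(f : 'S_(2 * n) | complete_matching f)
      if [forall x, nth (Ordinal d_gt0) (w ++ rev w) (f x) ==
                    nth (Ordinal d_gt0) (w ++ rev w) x]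
      then qC ^+ crossing_number f else 0.
  by rewrite {1}seqE fdot_field_vector big_mkcondr.
rewrite (eq_bigr _ (fun w _ => stateE w)).
(* For a fixed matching the weight does not depend on [w], so it remains to count the compatible
   words. *)
rewrite exchange_big /= Qtilde_matchings // rmorph_sum; apply: eq_bigr => f fc.
rewrite rmorphM !rmorphXn /= rmorph_nat -big_mkcond sumr_const.
rewrite -[_ *+ _]mulr_natl; congr (_ * _); rewrite -natrX -(card_palindromic_colorings d_gt0 fc).
by congr (_%:R); apply: eq_card => w; rewrite !inE.
Qed.

End Wick.

Theorem theorem1p4 (R : realType) (d : nat) (d_gt0 : (0 < d)%N)
    (q : R) (hq : -1 < q < 1) :
  T_op d hq = adjoint (T_op d hq) /\
  forall n : nat, (0 < n)%N ->
    vacuum_state (T_op d hq ^+ n) = (Qtilde n d%:R q)%:C.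
Proof.
split=> [|n n_gt0]; first by rewrite T_op_adj.
exact: vacuum_state_T_op_pow.
Qed.
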